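(* Let $n\ge 3$, let $\Pi=\{0,1\}^n\subset\mathbb{Z}^n$ with standard basis $e_1,\dots,e_n$, and let $\mathring{Y}\subset(\mathbb{C}^\times)^{\Pi}$ be the set of solutions $(x_I)_{I\in\Pi}$ of $$x_{I+e_j+e_\ell}\,x_{I+e_k}=x_I\,x_{I+e_j+e_k+e_\ell}+x_{I+e_j+e_k}\,x_{I+e_\ell}+x_{I+e_k+e_\ell}\,x_{I+e_j}$$ for all $1\le j<k<\ell\le n$ and all $I$ for which all eight indices lie in $\Pi$. Let $(\mathbb{C}^\times)^2$ act on $(\mathbb{C}^\times)^\Pi$ by $(t,u)$ multiplying the even coordinates by $t$ and the odd coordinates by $u$, let $\mathring{X}=\mathring{Y}/(\mathbb{C}^\times)^2$, and let $X$ be the closure of $\mathring{X}$ in $\mathbb{P}(\mathbb{C}^{\Pi^{\mathrm{even}}})\times\mathbb{P}(\mathbb{C}^{\Pi^{\mathrm{odd}}})$. Then $X$ is isomorphic to $\mathrm{IG}(n-1,2n)$, the variety of $(n-1)$-dimensional subspaces of $\mathbb{C}^{2n}$ that are isotropic with respect to a given non-degenerate quadratic form.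
   Context: An element $(i_1,\dots,i_n)\in\Pi$ is called even or odd according to the parity of $i_1+\cdots+i_n$; $\Pi^{\mathrm{even}}$ and $\Pi^{\mathrm{odd}}$ denote the sets of even and odd elements. A subspace $U$ is isotropic if the associated bilinear form vanishes identically on $U\times U$. *)

(* Defs.v *)
From mathcomp Require Import all_boot all_order all_algebra.
From mathcomp Require Import mpoly complex classical_sets reals.

Set Implicit Arguments.
Unset Strict Implicit.
Unset Printing Implicit Defensive.

Import GRing.Theory.
Local Open Scope ring_scope.
Local Open Scope classical_set_scope.

(** * Subvarieties of products of projective spaces, and their morphisms *)

Definition proj (F : fieldType) (I : finType) : Type :=
  {L : {vspace {ffun I -> F^o}} | \dim L == 1%N}.

Section MultiProjective.
Variables (F : fieldType) (A K : finType) (c : A -> K).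

(** A colouring [c] of the coordinates splits F^A into the blocks F^(c^-1(k)).
    [multiproj] is the product over all k of the projective spaces
    P(F^(c^-1(k))). *)
Definition block (k : K) : finType := {a : A | c a == k}.

Definition multiproj : Type := forall k : K, proj F (block k).

Definition restr (k : K) (x : {ffun A -> F}) : {ffun block k -> F^o} :=
  [ffun a => x (val a)].

(** [x] is a system of homogeneous coordinates of [p]: its block [k] spans the
    line [p k], and in particular is nonzero. *)
Definition hcoords (p : multiproj) (x : {ffun A -> F}) : Prop :=
  forall k : K, val (p k) = <[restr k x]>%VS.

(** The variables of a polynomial are the elements of [A], numbered by
    [enum_val]. *)
Definition peval (P : {mpoly F[#|A|]}) (x : {ffun A -> F}) : F :=
  P.@[fun i => x (enum_val i)].

(** Homogeneous of degree [d k] in the variables of each block [k]. *)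
Definition multihomog (d : K -> nat) (P : {mpoly F[#|A|]}) : Prop :=
  forall m, m \in msupp P ->
  forall k, (\sum_(i < #|A| | c (enum_val i) == k) m i)%N = d k.

Definition zclosed (Z : set multiproj) : Prop :=
  exists S : set {mpoly F[#|A|]},
    (forall P, S P -> exists d, multihomog d P) /\
    Z = [set p | forall P x, S P -> hcoords p x -> peval P x = 0].

Definition zclosure (X : set multiproj) : set multiproj := smallest zclosed X.

(** Open subsets of [X] for the induced Zariski topology. *)
Definition zopen_in (X U : set multiproj) : Prop :=
  exists2 Z, zclosed Z & U = X `\` Z.

(** [f] is regular on the open subset [U] of [X]: near each point of [U] it is
    a quotient of two multihomogeneous polynomials of the same multidegree.
    The values of [f] outside [U] are irrelevant. *)
Definition regular_on (X U : set multiproj) (f : multiproj -> F) : Prop :=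
  forall p, U p -> exists V : set multiproj,
    [/\ zopen_in X V, V p, V `<=` U &
     exists d P Q, [/\ multihomog d P, multihomog d Q &
       forall q x, V q -> hcoords q x ->
         peval Q x != 0 /\ f q = peval P x / peval Q x]].

End MultiProjective.

Section Morphisms.
Variable F : fieldType.
Variables (A1 K1 : finType) (c1 : A1 -> K1) (A2 K2 : finType) (c2 : A2 -> K2).
Implicit Types (X : set (multiproj F c1)) (Y : set (multiproj F c2)).

(** Continuous maps pulling regular functions back to regular functions. The
    values of [f] outside [X] are irrelevant. *)
Definition variety_morphism X Y (f : multiproj F c1 -> multiproj F c2) : Prop :=
  (forall p, X p -> Y (f p)) /\
  forall V, zopen_in Y V ->
    zopen_in X (X `&` f @^-1` V) /\
    forall g, regular_on Y V g -> regular_on X (X `&` f @^-1` V) (g \o f).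

End Morphisms.

Definition isomorphic_varieties (F : fieldType)
    (A1 K1 : finType) (c1 : A1 -> K1) (A2 K2 : finType) (c2 : A2 -> K2)
    (X : set (multiproj F c1)) (Y : set (multiproj F c2)) : Prop :=
  exists (f : multiproj F c1 -> multiproj F c2)
         (g : multiproj F c2 -> multiproj F c1),
    [/\ variety_morphism X Y f, variety_morphism Y X g,
        forall p, X p -> g (f p) = p & forall p, Y p -> f (g p) = p].

(** * Isotropic Grassmannians *)

Section Isotropic.
Variables (F : fieldType) (V : vectType F) (q : V -> F).

Definition polar (u v : V) : F := q (u + v) - q u - q v.

(** [polar] is symmetric, so linearity in one argument suffices. *)
Definition quadratic_form : Prop :=
  (forall a v, q (a *: v) = a ^+ 2 * q v) /\ forall u, scalar (polar u).

Definition nondegenerate_form : Prop :=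
  forall u, (forall v, polar u v = 0) -> u = 0.

Definition isotropic (U : {vspace V}) : Prop :=
  forall u v, u \in U -> v \in U -> polar u v = 0.

End Isotropic.

Definition ksubset (m k : nat) : finType := {S : {set 'I_m} | #|S| == k}.

(** The [j]-th element of [S], in increasing order. *)
Definition kelem (m k : nat) (S : ksubset m k) (j : 'I_k) : 'I_m :=
  enum_val (cast_ord (esym (eqP (valP S))) j).

(** The maximal minors of the matrix with rows [b]. *)
Definition plucker (F : fieldType) (m k : nat) (b : k.-tuple 'rV[F]_m) :
    {ffun ksubset m k -> F} :=
  [ffun S => \det (\matrix_(i < k, j < k) tnth b i 0 (kelem S j))].

(** A single block: [multiproj F (plucker_col m k)] is P(Lambda^k F^m). *)
Definition plucker_col (m k : nat) (_ : ksubset m k) : unit := tt.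
Arguments plucker_col : clear implicits.

(** A set of [k]-dimensional subspaces, as a subset of P(Lambda^k F^m) by means
    of the Pluecker embedding. *)
Definition plucker_image (F : fieldType) (m k : nat)
    (G : set {vspace 'rV[F]_m}) : set (multiproj F (plucker_col m k)) :=
  [set p | exists (U : {vspace 'rV[F]_m}) (b : k.-tuple 'rV[F]_m),
             [/\ G U, basis_of U b & hcoords p (plucker b)]].

Definition IG (F : fieldType) (k m : nat) (q : 'rV[F]_m -> F) :
    set (multiproj F (plucker_col m k)) :=
  plucker_image [set U | \dim U = k /\ isotropic q U].
Arguments IG {F} k {m} q.

(** * The multidimensional cube recurrence *)

Definition cube (n : nat) : finType := {ffun 'I_n -> bool}.

(** [I + e_j]; only used when [I j] is [false]. *)
Definition cube_add (n : nat) (I : cube n) (j : 'I_n) : cube n :=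
  [ffun i => I i (+) (i == j)].

Local Notation "I +e j" := (cube_add I j) (at level 50, left associativity).

Definition parity (n : nat) (I : cube n) : bool := odd (\sum_(i < n) I i)%N.

(** For j, k, l distinct, I + {0,1}e_j + {0,1}e_k + {0,1}e_l lies in {0,1}^n
    exactly when the coordinates j, k, l of [I] vanish. *)
Definition Yring (F : fieldType) (n : nat) : set {ffun cube n -> F} :=
  [set x : {ffun cube n -> F} | (forall I, x I != 0) /\
     forall (j k l : 'I_n) (I : cube n), (j < k)%N -> (k < l)%N ->
       I j = false -> I k = false -> I l = false ->
       x (I +e j +e l) * x (I +e k) =
         x I * x (I +e j +e k +e l) + x (I +e j +e k) * x (I +e l)
         + x (I +e k +e l) * x (I +e j)].

Definition torus_act (F : fieldType) (n : nat) (t u : F)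
    (x : {ffun cube n -> F}) : {ffun cube n -> F} :=
  [ffun I => (if parity I then u else t) * x I].

(** The fibres of x |-> [x] are the orbits of [torus_act]. *)
Lemma hcoords_torus (F : fieldType) (n : nat)
    (p : multiproj F (@parity n)) (x y : {ffun cube n -> F}) :
  hcoords p x ->
  hcoords p y <->
  exists t u : F, [/\ t != 0, u != 0 & y = torus_act t u x].
Proof.
move=> hx; split=> [hy|[t] [u] [t0 u0 ->] k].
- have H k : exists2 t : F, t != 0 & restr (@parity n) k y = t *: restr (@parity n) k x.
    have : restr (@parity n) k y \in <[restr (@parity n) k x]>%VS by rewrite -hx hy memv_line.
    case/vlineP=> t E; exists t => //; apply/eqP => t0.
    have := eqP (valP (p k)); rewrite hy E t0 scale0r.
    by rewrite dim_vline eqxx.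
  have [t t0 Et] := H false; have [u u0 Eu] := H true.
  exists t, u; split=> //; apply/ffunP=> I; rewrite ffunE.
  case E: (parity I).
    have e : parity I == true by rewrite E.
    by move/ffunP/(_ (exist _ I e)): Eu; rewrite !ffunE.
  have e : parity I == false by rewrite E.
  by move/ffunP/(_ (exist _ I e)): Et; rewrite !ffunE.
- pose s := if k then u else t.
  have s0 : s != 0 by rewrite /s; case: ifP.
  have -> : restr (@parity n) k (torus_act t u x) = s *: restr (@parity n) k x.
    by apply/ffunP=> a; rewrite !ffunE (eqP (valP a)).
  rewrite hx; apply/eqP; rewrite eqEsubv -!memvE; apply/andP; split.
    by apply/vlineP; exists s^-1; rewrite scalerA mulVf // scale1r.
  by apply/vlineP; exists s.
Qed.

(** The quotient of [Yring] by [torus_act], as a subset of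
    P(F^even) x P(F^odd). *)
Definition Xring (F : fieldType) (n : nat) : set (multiproj F (@parity n)) :=
  [set p | exists2 x, Yring x & hcoords p x].

Definition Xvar (F : fieldType) (n : nat) : set (multiproj F (@parity n)) :=
  zclosure (@Xring F n).
Arguments Xvar : clear implicits.

(* Main.v *)
Require Import Defs.
From HB Require Import structures.
From mathcomp Require Import all_boot all_order all_algebra.
From mathcomp Require Import fingroup perm mpoly complex boolp classical_sets reals.
From mathcomp Require Import ring zify.

(* Up to the sign change [twist], a point of Xvar is a pair (even spinor, odd
   spinor), with the cube as a basis of the spinor space of the quadratic form:
   C^(2n) acts on it by Clifford multiplication [gam].  The cube recurrences say
   that a pair with no vanishing coordinate is annihilated by an
   (n-1)-dimensional space W, which is then isotropic; conversely an isotropic W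
   of dimension n-1 annihilates exactly one line of even and one line of odd
   spinors.  The pairs annihilated by such a W form a closed set, given by rank
   conditions, in which the pairs with no vanishing coordinate are dense, since
   the elements 1 + t u v of the spin group enlarge the support of a spinor.
   Both directions of the correspondence between pairs and spaces W are
   kernels of matrices of constant rank, hence locally polynomial. *)

Set Implicit Arguments.
Unset Strict Implicit.
Unset Printing Implicit Defensive.

Import Order.TTheory GRing.Theory Num.Theory.
Local Open Scope ring_scope.
Local Open Scope classical_set_scope.

(** * Multihomogeneous functions and locally polynomial maps *)

Section HomogeneousFunctions.
Variables (F : fieldType) (A K : finType) (c : A -> K).
Implicit Types (d e : K -> nat) (h : {ffun A -> F} -> F).

(** The number n - 1 comes from a count. For a spinor y and a vector v, an alternating sum of
    products of y and [gam v y] over a 2-face of the cube is linear in v, with the cube relations as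
    coefficients ([crel_gam]). If these vanish and y has no zero coordinate, [gam v y] is determined
    by its values at the origin and its n neighbours, so killing y costs v only n + 1 linear
    equations in a space of dimension 2n. In the other direction, each further isotropic dimension
    halves the space of killed spinors, starting from 2^n. Dimension n - 1 leaves a plane, made of
    one line of each parity; dimension n leaves one line, which cannot contain both an even and an
    odd spinor. Hence a pair with both parts nonzero is killed by a space of dimension at most n -
    1, and this makes both ranks constant: n + 1 for the equations on v given y, and 2^n - 2 for the
    equations on y given W. The two parts of a pair carry independent scalars. This is harmless
    because Clifford multiplication exchanges the parities. *)

Definition homogfun d h : Prop :=
  exists2 P : {mpoly F[#|A|]}, multihomog c d P & forall x, peval P x = h x.

Lemma homogfun_ext d d' h h' :
  d =1 d' -> h =1 h' -> homogfun d h -> homogfun d' h'.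
Proof.
move=> ed eh [P hP eP]; exists P => [m mP k|x]; last by rewrite eP eh.
by rewrite (hP m mP) ed.
Qed.

Lemma homogfun0 d : homogfun d (fun=> 0).
Proof.
exists 0 => [m|x]; first by rewrite msupp0.
by rewrite /peval meval0.
Qed.

Lemma homogfunC a : homogfun (fun=> 0%N) (fun=> a).
Proof.
exists a%:MP => [m|x]; last by rewrite /peval mevalC.
rewrite msuppC; case: ifP => // _; rewrite inE => /eqP-> k.
by rewrite big1 // => i _; rewrite mnm0E.
Qed.

Lemma homogfun_coord a : homogfun (fun k => (c a == k)) (fun x => x a).
Proof.
exists 'X_(enum_rank a) => [m|x]; last first.
  by rewrite /peval mevalXU enum_rankK.
rewrite msuppX inE => /eqP-> k.
have [<-|nk] := eqVneq (c a) k.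
  rewrite (bigD1 (enum_rank a)) ?enum_rankK //= mnm1E eqxx big1 // => i.
  by case/andP=> _ ni; rewrite mnm1E eq_sym (negPf ni).
rewrite big1 // => i /eqP ci; rewrite mnm1E; case: eqP => // ei.
by move: nk; rewrite -ci -ei enum_rankK eqxx.
Qed.

Lemma homogfunD d h1 h2 :
  homogfun d h1 -> homogfun d h2 -> homogfun d (fun x => h1 x + h2 x).
Proof.
move=> [P hP eP] [Q hQ eQ]; exists (P + Q) => [m|x]; last first.
  by rewrite -eP -eQ /peval mevalD.
by move/msuppD_le; rewrite mem_cat => /orP[]; [apply: hP|apply: hQ].
Qed.

Lemma homogfunM d e h1 h2 : homogfun d h1 -> homogfun e h2 ->
  homogfun (fun k => d k + e k)%N (fun x => h1 x * h2 x).
Proof.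
move=> [P hP eP] [Q hQ eQ]; exists (P * Q) => [m|x]; last first.
  by rewrite -eP -eQ /peval mevalM.
move/msuppM_le/allpairsP=> [[m1 m2] /= [h1P h2Q ->]] k.
by under eq_bigr do rewrite mnmDE; rewrite big_split /= (hP _ h1P) (hQ _ h2Q).
Qed.

Lemma homogfunZ d a h : homogfun d h -> homogfun d (fun x => a * h x).
Proof. by move=> hh; apply: homogfun_ext (homogfunM (homogfunC a) hh). Qed.

Lemma homogfunN d h : homogfun d h -> homogfun d (fun x => - h x).
Proof.
move/(homogfunZ (-1)); apply: homogfun_ext => // x.
by rewrite mulN1r.
Qed.

Lemma homogfun_sum (T : eqType) (r : seq T) (Q : pred T) d
    (h : T -> {ffun A -> F} -> F) :
  (forall i, i \in r -> Q i -> homogfun d (h i)) ->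
  homogfun d (fun x => \sum_(i <- r | Q i) h i x).
Proof.
elim: r => [|i r IH] hr.
  by apply: homogfun_ext (homogfun0 d) => // x; rewrite big_nil.
have /IH Hr : forall j, j \in r -> Q j -> homogfun d (h j).
  by move=> j jr; apply: hr; rewrite inE jr orbT.
case Qi: (Q i).
  have := homogfunD (hr i (mem_head _ _) Qi) Hr.
  by apply: homogfun_ext => // x; rewrite big_cons Qi.
by apply: homogfun_ext Hr => // x; rewrite big_cons Qi.
Qed.

Lemma homogfun_prod (T : eqType) (r : seq T) (d : T -> K -> nat)
    (h : T -> {ffun A -> F} -> F) :
  (forall i, i \in r -> homogfun (d i) (h i)) ->
  homogfun (fun k => \sum_(i <- r) d i k)%N (fun x => \prod_(i <- r) h i x).
Proof.
elim: r => [|i r IH] hr.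
  by apply: homogfun_ext (homogfunC 1) => x; rewrite big_nil.
have := homogfunM (hr i (mem_head _ _))
  (IH (fun j jr => hr j (mem_behead (s := i :: r) jr))).
by apply: homogfun_ext => x; rewrite big_cons.
Qed.

Lemma homogfunX d h t : homogfun d h ->
  homogfun (fun k => t * d k)%N (fun x => h x ^+ t).
Proof.
move=> hh; elim: t => [|t IH].
  by apply: homogfun_ext (homogfunC 1).
by apply: homogfun_ext (homogfunM hh IH) => x; rewrite ?mulSn ?exprS.
Qed.

(** Every Leibniz term takes exactly one entry from each column, so the degree may vary from column
    to column without spoiling homogeneity. The matrices [gmx] below need this freedom. *)
Lemma homogfun_det r (d : 'I_r -> K -> nat)
    (M : {ffun A -> F} -> 'M[F]_r) :
  (forall i j, homogfun (d j) (fun x => M x i j)) ->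
  homogfun (fun k => \sum_j d j k)%N (fun x => \det (M x)).
Proof.
move=> hM; apply: homogfun_sum => s _ _.
apply: homogfunZ; have := homogfun_prod (r := index_enum 'I_r)
   (h := fun i x => M x i (s i)) (d := fun i => d (s i)).
move=> /(_ (fun i _ => hM i (s i))); apply: homogfun_ext => k //.
by rewrite [RHS](reindex_inj (@perm_inj _ s)).
Qed.

End HomogeneousFunctions.

(** All coordinates of [phi] share the multidegree [D], whatever their block in the target, so only
    the total degree of [Q] enters. *)
Lemma homogfun_comp (F : fieldType) (A1 K1 : finType) (c1 : A1 -> K1)
    (A2 K2 : finType) (c2 : A2 -> K2) (e : K2 -> nat) (Q : {mpoly F[#|A2|]})
    (D : K1 -> nat) (phi : {ffun A1 -> F} -> {ffun A2 -> F}) :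
  multihomog c2 e Q -> (forall b, homogfun c1 D (fun x => phi x b)) ->
  homogfun c1 (fun k => (\sum_k2 e k2) * D k)%N (fun x => peval Q (phi x)).
Proof.
move=> hQ hphi.
apply: (@homogfun_ext _ _ _ _ _ _ (fun x =>
    \sum_(m <- msupp Q) Q@_m * \prod_i (phi x (enum_val i)) ^+ m i)) => //.
apply: homogfun_sum => m mQ _; apply: homogfunZ.
have := @homogfun_prod F A1 K1 c1 'I_#|A2| (index_enum _)
   (fun i k => m i * D k)%N (fun i x => phi x (enum_val i) ^+ m i)
   (fun i _ => homogfunX _ (hphi _)).
apply: homogfun_ext => // k; rewrite -big_distrl /=; congr (_ * _)%N.
rewrite (partition_big (fun i => c2 (enum_val i)) xpredT) //=.
by apply: eq_bigr => k2 _; rewrite -(hQ m mQ k2).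
Qed.

(** * Homogeneous coordinates and their rescaling, block by block *)

Section HomogeneousCoordinates.
Variables (F : fieldType) (A K : finType) (c : A -> K).
Local Notation mp := (multiproj F c).
Implicit Types (p : mp) (x y : {ffun A -> F}).

Lemma vline_eq (V : vectType F) (u v : V) : u != 0 ->
  <[u]>%VS = <[v]>%VS -> exists2 t, t != 0 & v = t *: u.
Proof.
move=> u0 e; have : v \in <[u]>%VS by rewrite e memv_line.
case/vlineP=> t ev; exists t => //; apply: contraNneq u0 => t0.
by rewrite -memv0 memvE e ev t0 scale0r -memvE mem0v.
Qed.

Lemma vline_scale (V : vectType F) (u : V) t : t != 0 -> <[t *: u]>%VS = <[u]>%VS.
Proof.
move=> t0; apply/eqP; rewrite eqEsubv -!memvE; apply/andP; split.
  by apply/vlineP; exists t.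
by apply/vlineP; exists t^-1; rewrite scalerA mulVf // scale1r.
Qed.

Lemma hcoords_restr_neq0 p x k : hcoords p x -> restr c k x != 0.
Proof.
move=> /(_ k) e; apply/eqP => x0; have := eqP (valP (p k)).
by rewrite e x0 dim_vline eqxx.
Qed.

Lemma hcoords_neq0 p x k : hcoords p x -> exists2 a, c a = k & x a != 0.
Proof.
move=> hx; have xn := hcoords_restr_neq0 k hx.
case: (boolP [exists a : A, (c a == k) && (x a != 0)]).
  by case/existsP=> a /andP[/eqP ca xa]; exists a.
move/existsPn=> H; case/eqP: xn; apply/ffunP => a; rewrite !ffunE.
by have := H (val a); rewrite (valP a) negbK => /eqP.
Qed.

Lemma hcoords_scale p x y : hcoords p x -> hcoords p y ->
  exists2 t : K -> F, (forall k, t k != 0) & forall a, y a = t (c a) * x a.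
Proof.
move=> hx hy.
have H k : exists t, t != 0 /\ restr c k y = t *: restr c k x.
  have [||t t0 e] := @vline_eq _ (restr c k x) (restr c k y).
  - exact: hcoords_restr_neq0 hx.
  - by rewrite -hx hy.
  by exists t.
have [t Ht] := choice H; exists t => [k|a]; first by case: (Ht k).
have [_ /ffunP/(_ (exist _ a (eqxx (c a))))] := Ht (c a).
by rewrite !ffunE.
Qed.

Lemma scale_hcoords p x y (t : K -> F) : hcoords p x -> (forall k, t k != 0) ->
  (forall a, y a = t (c a) * x a) -> hcoords p y.
Proof.
move=> hx t0 e k; rewrite (hx k) -(vline_scale (restr c k x) (t0 k)); congr <[_]>%VS.
by apply/ffunP => a; rewrite !ffunE e (eqP (valP a)).
Qed.

Lemma hcoords_ex p : exists x, hcoords p x.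
Proof.
have H k : exists v, val (p k) = <[v]>%VS.
  have := eqP (valP (p k)); move: (val (p k)) => L dL; exists (vpick L).
  apply/eqP; rewrite eq_sym eqEdim -memvE memv_pick dL dim_vline.
  rewrite vpick0; case: eqP => // L0; move: dL; rewrite L0 dimv0.
  by [].
pose v k := sval (cid (H k)).
have Hv k : val (p k) = <[v k]>%VS := svalP (cid (H k)).
exists [ffun a => v (c a) (exist _ a (eqxx (c a)))] => k; rewrite Hv; congr <[_]>%VS.
apply/ffunP => -[a ca]; rewrite !ffunE /=; have ck := eqP ca; subst k.
by congr (v _ _); apply: val_inj.
Qed.

Lemma hcoords_inj p p' x : hcoords p x -> hcoords p' x -> p = p'.
Proof.
move=> h h'; apply: functional_extensionality_dep => k; apply: val_inj.
by rewrite (h k) (h' k).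
Qed.

Lemma hcoords_mk x : (forall k, exists2 a, c a = k & x a != 0) ->
  exists p, hcoords p x.
Proof.
move=> H; have d1 k : \dim <[restr c k x]>%VS == 1%N.
  have [a ca xa] := H k; rewrite dim_vline eqb1; apply/eqP => r0.
  move/eqP: ca => ca.
  have /eqP := congr1 (fun g : {ffun block c k -> F^o} => g (exist _ a ca)) r0.
  by rewrite !ffunE (negPf xa).
by exists (fun k => exist (fun L : {vspace _} => \dim L == 1%N) _ (d1 k)).
Qed.

Lemma peval_scale d (P : {mpoly F[#|A|]}) x y (t : K -> F) :
  multihomog c d P -> (forall a, y a = t (c a) * x a) ->
  peval P y = (\prod_k t k ^+ d k) * peval P x.
Proof.
move=> hP e; rewrite /peval !mevalE big_distrr /= 2!big_seq.
apply: eq_bigr => m mP; rewrite mulrCA; congr (_ * _).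
under eq_bigr do rewrite e exprMn.
rewrite big_split /=; congr (_ * _).
rewrite (partition_big (fun i => c (enum_val i)) xpredT) //=.
apply: eq_bigr => k _; rewrite -(hP m mP k) -prodrXr.
by apply: eq_bigr => i /eqP->.
Qed.

Lemma peval_neq0_indep d (P : {mpoly F[#|A|]}) p x y :
  multihomog c d P -> hcoords p x -> hcoords p y -> peval P x != 0 -> peval P y != 0.
Proof.
move=> hP hx hy; have [t t0 e] := hcoords_scale hx hy.
rewrite (peval_scale hP e) => H; rewrite mulf_neq0 //.
by apply/prodf_neq0 => k _; rewrite expf_neq0.
Qed.

End HomogeneousCoordinates.

(** * Maps that are locally polynomial in homogeneous coordinates are morphisms *)

Section LocallyPolynomial.
Variable F : fieldType.
Variables (A1 K1 : finType) (c1 : A1 -> K1) (A2 K2 : finType) (c2 : A2 -> K2).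
Variables (X : set (multiproj F c1)) (Y : set (multiproj F c2)).
Variable f : multiproj F c1 -> multiproj F c2.

(** The neighbourhood of [p] on which [phi] represents [f] is the locus where [delta] does not
    vanish; elsewhere [phi] may degenerate, even to zero. *)
Definition locally_polynomial : Prop :=
  forall p, X p ->
  exists d (delta : {ffun A1 -> F} -> F) D (phi : {ffun A1 -> F} -> {ffun A2 -> F}),
   [/\ homogfun c1 d delta, forall b, homogfun c1 D (fun x => phi x b),
       exists2 x, hcoords p x & delta x != 0 &
       forall q x, X q -> hcoords q x -> delta x != 0 -> hcoords (f q) (phi x)].

(* Being closed is a local property: the polynomials delta * (Q o phi), with Q
   an equation of Z, cut out the preimage of Z. *)
Lemma locally_polynomial_morphism :
  (forall p, X p -> Y (f p)) -> locally_polynomial -> variety_morphism X Y f.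
Proof.
move=> XY lp; split=> // V hV.
have cont W : zopen_in Y W -> zopen_in X (X `&` f @^-1` W).
  move=> [Z [S [hS ->]] ->].
  (* All forms vanishing at the points of [X] that [f] sends into [Z]: a choice of equations that
     does not depend on the local data. *)
  pose S' := [set P | (exists d, multihomog c1 d P) /\
    forall q x, X q -> hcoords q x ->
      (forall Q y, S Q -> hcoords (f q) y -> peval Q y = 0) -> peval P x = 0].
  exists [set p | forall P x, S' P -> hcoords p x -> peval P x = 0].
    by exists S'; split=> // P [].
  apply/seteqP; split=> p /= [Xp H]; split=> //.
    move=> HS'; case: H => _; apply=> Q y SQ hy; apply/eqP/negPn/negP => Qy.
    have [d [delta [D [phi [[Pd hPd ePd] hphi [x hx dx] hf]]]]] := lp p Xp.
    have [e hQ] := hS Q SQ.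
    have hfx := hf p x Xp hx dx.
    have [PQ hPQ ePQ] := homogfun_comp hQ hphi.
    have [P hP eP] : homogfun c1 (fun k => d k + (\sum_k2 e k2) * D k)%N
        (fun x => delta x * peval Q (phi x)).
      by apply: homogfunM; [exists Pd|exists PQ].
    have /negP := peval_neq0_indep hQ hy hfx Qy; apply.
    have : peval P x = 0.
      apply: HS' => //; split; first by eexists; exact: hP.
      move=> q z Xq hz vq; rewrite eP; have [->|dz] := eqVneq (delta z) 0.
        by rewrite mul0r.
      by rewrite (vq Q (phi z)) ?mulr0 //; apply: hf.
    by rewrite eP => /eqP; rewrite mulf_eq0 (negPf dx).
  split; first exact: XY.
  move=> HS; apply: H => P x [_ HP] hx.
  exact: HP Xp hx HS.
split; first exact: cont.
move=> g hg p [Xp Vp]; have [V' [oV' V'p V'V [d [P [Q [hP hQ hPQ]]]]]] := hg (f p) Vp.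
have [e [delta [D [phi [[Pd hPd ePd] hphi [x hx dx] hf]]]]] := lp p Xp.
have [Z [S [hS eZ]] eZ'] := cont _ oV'.
have inV q : X q -> V' (f q) -> ~ Z q.
  move=> Xq Vq; have : (X `&` f @^-1` V') q by [].
  by rewrite eZ' => -[].
have inV' q : X q -> ~ Z q -> V' (f q).
  move=> Xq Vq; have : (X `\` Z) q by [].
  by rewrite -eZ' => -[].
(* These products cut out the union of [Z] and the zero locus of [delta]; outside it [phi]
   represents [f], and the fraction for [g] can be composed with it. *)
pose S' := [set P | exists2 P', S P' & P = P' * Pd].
pose Z' := [set p | forall P x, S' P -> @hcoords F A1 K1 c1 p x -> peval P x = 0].
have evS' P' z : peval (P' * Pd) z = peval P' z * delta z.
  by rewrite -ePd /peval mevalM.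
have Z'P q z : hcoords q z -> ~ Z' q -> ~ Z q /\ delta z != 0.
  move=> hz nZ'; split.
    move=> Zq; apply: nZ' => R y [P' SP' ->] hy; rewrite evS'.
    by move: Zq; rewrite eZ => /(_ P' y SP' hy) ->; rewrite mul0r.
  apply/eqP => d0; apply: nZ' => R y [P' SP' ->] hy; rewrite evS'.
  have [->|] := eqVneq (delta y) 0; first by rewrite mulr0.
  by rewrite -ePd => /(peval_neq0_indep hPd hy hz); rewrite ePd d0 eqxx.
have Z'c : zclosed Z'.
  exists S'; split=> // R [P' SP' ->]; have [d' hd'] := hS _ SP'.
  exists (fun k => d' k + e k)%N => m.
  move/msuppM_le/allpairsP=> [[m1 m2] /= [h1P h2Q ->]] k.
  by under eq_bigr do rewrite mnmDE; rewrite big_split /= (hd' _ h1P) (hPd _ h2Q).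
exists (X `\` Z'); split.
- by exists Z'.
- split=> // Z'p; have := inV p Xp V'p; apply.
  rewrite eZ => P' y SP' hy; apply/eqP/negPn/negP => Py.
  have [d' hd'] := hS _ SP'.
  have /eqP := Z'p (P' * Pd) x (ex_intro2 _ _ _ SP' erefl) hx.
  rewrite evS' mulf_eq0 (negPf dx) orbF; apply/negP.
  exact: peval_neq0_indep hd' hy hx Py.
- move=> q [Xq nZ']; split=> //; apply: V'V; apply: inV' => //.
  by have [z hz] := hcoords_ex q; case: (Z'P q z hz nZ').
have [PP hPP ePP] := homogfun_comp hP hphi.
have [QQ hQQ eQQ] := homogfun_comp hQ hphi.
eexists _, PP, QQ; split; [exact: hPP|exact: hQQ|].
move=> q z [Xq nZ'] hz; have [nZ dz] := Z'P q z hz nZ'.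
rewrite ePP eQQ; apply: hPQ; [exact: inV'|exact: hf].
Qed.

End LocallyPolynomial.

(** * Local kernels, Pluecker coordinates, symmetric matrices *)

Section MatrixTools.
Variable F : fieldType.

Lemma row_free0P k a (B : 'M[F]_(k, a)) :
  (forall u : 'rV_k, u *m B = 0 -> u = 0) -> row_free B.
Proof.
move=> H; rewrite -kermx_eq0; apply/eqP/row_matrixP => i; rewrite row0.
by apply: H; rewrite -row_mul mulmx_ker row0.
Qed.

Lemma row_free_mul0 k a p (B : 'M[F]_(k, a)) (u : 'M_(p, k)) :
  row_free B -> u *m B = 0 -> u = 0.
Proof. by move=> fB /eqP; rewrite mulmx_free_eq0 // => /eqP. Qed.

Lemma det_row_replace r (N : 'M[F]_r) (w : 'rV_r) j :
  (w *m \adj N) 0 j = \det (\matrix_(s, t) if s == j then w 0 t else N s t).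
Proof.
rewrite (expand_det_row _ j) mxE; apply: eq_bigr => t _; rewrite !mxE eqxx.
congr (_ * _); rewrite /cofactor; congr (_ * \det _).
by apply/matrixP => s u; rewrite !mxE eq_sym (negPf (neq_lift _ _)).
Qed.

Lemma det_col_replace r (N : 'M[F]_r) (w : 'cV_r) i :
  (\adj N *m w) i 0 = \det (\matrix_(s, t) if t == i then w s 0 else N s t).
Proof.
rewrite (expand_det_col _ i) mxE; apply: eq_bigr => t _; rewrite !mxE eqxx mulrC.
congr (_ * _); rewrite /cofactor; congr (_ * \det _).
by apply/matrixP => s u; rewrite !mxE eq_sym (negPf (neq_lift _ _)).
Qed.

(** The determinant condition gives [S *m M] rank at least r, so its rows span those of [M] and
    [M = Z *m (S *m M)] for some [Z]. Reading this on the columns [g] identifies [Z] as [colsub g M]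
    times the inverse of [S *m colsub g M]; the adjugate clears the denominator. *)
Lemma schur_complement a b r (M : 'M[F]_(a, b)) (S : 'M_(r, a)) (g : 'I_r -> 'I_b) :
  (\rank M <= r)%N -> \det (S *m colsub g M) != 0 ->
  \det (S *m colsub g M) *: M = colsub g M *m \adj (S *m colsub g M) *m S *m M.
Proof.
move=> rM dN; set N := S *m colsub g M.
have rN : \rank N = r by apply: mxrank_unit; rewrite unitmxE unitfE.
have cE (Q : 'M_(r, a)) : Q *m colsub g M = colsub g (Q *m M).
  by apply/matrixP => i j; rewrite !mxE; apply: eq_bigr => t _; rewrite !mxE.
have rSM : (r <= \rank (S *m M))%N.
  rewrite -{1}rN /N cE -[colsub g _](mulmx1 (colsub g (S *m M))).
  have -> : colsub g (S *m M) *m 1%:M = S *m M *m colsub g 1%:M.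
    by rewrite mulmx1 mulmx_colsub mulmx1.
  exact: mxrankM_maxl.
have /submxP[Z eZ] : (M <= S *m M)%MS.
  have := mxrank_leqif_sup (submxMl S M).
  by case=> _; rewrite eqn_leq mxrankM_maxr => <-; rewrite (leq_trans rM).
have eZ' : colsub g M = Z *m N by rewrite {1}eZ /N cE mulmx_colsub.
rewrite eZ' -(mulmxA Z) mul_mx_adj -(mulmxA (Z *m _)) -mulmxA mul_scalar_mx.
by rewrite -scalemxAr -eZ.
Qed.

End MatrixTools.

(** * Polynomial bases of the kernels of a family of matrices of constant rank *)

Section LocalKernel.
Variables (F : fieldType) (A K : finType) (c : A -> K) (a b k : nat).
Variables (d : 'I_b -> K -> nat) (M : {ffun A -> F} -> 'M[F]_(a, b)).
Hypothesis hM : forall i j, homogfun c (d j) (fun x => M x i j).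

(* Kf x is the image of a kernel K0 of M x0 under the adjugate form of the
   projection onto the kernel of M x along a fixed complement. *)
Lemma local_kernel x0 (K0 : 'M[F]_(k, a)) : row_free K0 -> K0 *m M x0 = 0 ->
  exists e delta (Kf : {ffun A -> F} -> 'M[F]_(k, a)),
  [/\ homogfun c e delta, forall i j, homogfun c e (fun x => Kf x i j),
      delta x0 != 0, Kf x0 = delta x0 *: K0 &
      forall x, (\rank (M x) <= \rank (M x0))%N -> delta x != 0 ->
        row_free (Kf x) /\ Kf x *m M x = 0].
Proof.
move=> fK0 K00; set r := \rank (M x0).
(* A maximal independent set of columns of [M x0] and a left inverse of it, which normalises [N x0]
   to the identity and hence [delta x0] to 1. *)
have [g [S SE]] : exists (g : 'I_r -> 'I_b) (S : 'M_(r, a)),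
    S *m colsub g (M x0) = 1%:M.
  rewrite /r -mxrank_tr; set f := maxrankfun (M x0)^T.
  exists f, (pinvmx (colsub f (M x0))); apply: mulVpmx.
  by rewrite /row_full -mxrank_tr trmx_mxsub; apply: maxrowsub_free.
pose N x := S *m colsub g (M x); pose delta x := \det (N x).
pose e kk := (\sum_(t < r) d (g t) kk)%N.
have hN s t : homogfun c (d (g t)) (fun x => N x s t).
  pose h x := \sum_u S s u * M x u (g t).
  apply: (@homogfun_ext _ _ _ _ _ _ h) => // [x|].
    by rewrite !mxE; apply: eq_bigr => u _; rewrite mxE.
  by apply: homogfun_sum => u _ _; apply: homogfunZ.
have hdelta : homogfun c e delta by apply: homogfun_det.
pose P x := delta x *: 1%:M - colsub g (M x) *m \adj (N x) *m S.
have hP i j : homogfun c e (fun x => P x i j).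
  (* By Cramer, multiplying a row by [\adj (N x)] yields the determinants of [N x] with one row
     replaced. The columns keep their degrees, so these have the same multidegree [e] as [delta]. *)
  pose h x := delta x * (i == j)%:R - \sum_u S u j *
    \det (\matrix_(s, t) if s == u then M x i (g t) else N x s t).
  apply: (@homogfun_ext _ _ _ _ _ _ h) => // [x|].
    rewrite /h /P !mxE; congr (_ - _); apply: eq_bigr => u _.
    rewrite mulrC; congr (_ * _).
    have := det_row_replace (N x) (row i (colsub g (M x))) u.
    rewrite -row_mul mxE => ->; congr (\det _); apply/matrixP => s t.
    by rewrite !mxE.
  apply: homogfunD.
    apply: homogfun_ext (homogfunZ (i == j)%:R hdelta) => // x.
    by rewrite mulrC.
  apply: homogfunN; apply: homogfun_sum => u _ _; apply: homogfunZ.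
  apply: (@homogfun_det _ _ _ _ _ (fun t => d (g t))) => s t.
  have [su|su] := eqVneq s u.
    by apply: homogfun_ext (hM i (g t)) => // x; rewrite mxE su eqxx.
  by apply: homogfun_ext (hN s t) => // x; rewrite [RHS]mxE (negPf su).
exists e, delta, (fun x => K0 *m P x); split=> //.
- move=> i j; pose h x := \sum_u K0 i u * P x u j.
  apply: (@homogfun_ext _ _ _ _ _ _ h) => // [x|]; first by rewrite !mxE.
  by apply: homogfun_sum => u _ _; apply: homogfunZ.
- by rewrite /delta /N SE det1 oner_eq0.
- rewrite mulmxBr -scalemxAr mulmx1 !mulmxA mulmx_colsub K00.
  have -> : colsub g (0 : 'M[F]_(k, b)) = 0 by apply/matrixP => ? ?; rewrite !mxE.
  by rewrite !mul0mx subr0.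
move=> x rx dx; split; last first.
  rewrite -mulmxA mulmxBl -scalemxAl mul1mx -schur_complement ?subrr ?mulmx0 //.
apply: row_free0P => u; rewrite mulmxA mulmxBr -scalemxAr mulmx1.
rewrite !mulmxA; set w := _ *m \adj _; move/eqP; rewrite subr_eq0 => /eqP E.
(* Multiplying [E] by [colsub g (M x0)] isolates [w], since [K0] kills this matrix and [S] inverts
   it. *)
have w0 : w = 0.
  have := congr1 (fun Q => Q *m colsub g (M x0)) E => /=.
  rewrite -[w *m S *m _]mulmxA SE mulmx1 => <-.
  rewrite -scalemxAl -mulmxA mulmx_colsub K00.
  have -> : colsub g (0 : 'M[F]_(k, b)) = 0 by apply/matrixP => ? ?; rewrite !mxE.
  by rewrite mulmx0 scaler0.
move/eqP: E; rewrite w0 mul0mx scaler_eq0 (negPf dx) /= => /eqP.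
exact: row_free_mul0.
Qed.

End LocalKernel.

(** * Pluecker coordinates and the recovery of a subspace from them *)

Section Pluecker.
Variables (F : fieldType) (m k : nat).
Local Notation pcol := (plucker_col m k).
Implicit Types (B : 'M[F]_(k, m)) (S : ksubset m k) (p : {ffun ksubset m k -> F}).

Definition pl B : {ffun ksubset m k -> F} := [ffun S => \det (colsub (kelem S) B)].

Lemma plucker_pl (b : k.-tuple 'rV[F]_m) : plucker b = pl (\matrix_i tnth b i).
Proof.
apply/ffunP => S; rewrite !ffunE; congr (\det _).
by apply/matrixP => i j; rewrite !mxE.
Qed.

Lemma plM (T : 'M[F]_k) B : pl (T *m B) = [ffun S => \det T * pl B S].
Proof.
by apply/ffunP => S; rewrite !ffunE -mulmx_colsub det_mulmx.
Qed.

(** The determinant is zero if [g] repeats a column, and a signed Pluecker coordinate otherwise. The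
    point is that [l] does not depend on [B]. *)
Lemma det_colsub (g : 'I_k -> 'I_m) :
  exists l : ksubset m k -> F, forall B, \det (colsub g B) = \sum_S l S * pl B S.
Proof.
case: (boolP (injectiveb g)) => [/injectiveP gi|]; last first.
  case/injectivePn=> i [j] ij gij; exists (fun=> 0) => B.
  rewrite -det_tr (determinant_alternate ij) => [|t]; last by rewrite !mxE gij.
  by rewrite big1 // => S _; rewrite mul0r.
have cS : #|[set g i | i : 'I_k]%SET| == k by rewrite card_imset ?card_ord.
pose S : ksubset m k := exist (fun S : {set 'I_m} => #|S| == k) _ cS.
have gS i : g i \in val S by apply: imset_f.
pose s0 i := cast_ord (eqP cS) (enum_rank_in (gS i) (g i)).
have ks i : kelem S (s0 i) = g i.
  rewrite /kelem /s0 -[RHS](enum_rankK_in (gS i) (gS i)); congr enum_val.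
  exact: val_inj.
have s0i : injective s0 by move=> i j e; apply: gi; rewrite -!ks e.
pose s := perm s0i.
exists (fun S' => (-1) ^+ s *+ (S' == S)) => B.
rewrite (bigD1 S) //= eqxx mulr1n big1 ?addr0 => [|S' /negPf->]; last first.
  by rewrite mulr0n mul0r.
have -> : colsub g B = col_perm s (colsub (kelem S) B).
  by apply/matrixP => i j; rewrite !mxE permE ks.
by rewrite col_permE det_mulmx det_perm odd_permV mulrC ffunE.
Qed.

(** A polynomial inverse of the Pluecker embedding on the chart where coordinate [S] is nonzero. By
    Cramer, the entries of [\adj (colsub (kelem S) B) *m B] are minors of [B] with one column of [S]
    exchanged, hence linear in the Pluecker coordinates. *)
Lemma plucker_echelon S :
  exists E : {ffun ksubset m k -> F} -> 'M[F]_(k, m),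
  [/\ forall i j, homogfun pcol (fun=> 1%N) (fun p => E p i j),
      forall t p, E [ffun S => t * p S] = t *: E p &
      forall B, E (pl B) = \adj (colsub (kelem S) B) *m B].
Proof.
pose g (i : 'I_k) (j : 'I_m) (s : 'I_k) := if s == i then j else kelem S s.
pose l i j := sval (cid (det_colsub (g i j))).
have lP i j := svalP (cid (det_colsub (g i j))).
exists (fun p => \matrix_(i, j) \sum_S l i j S * p S); split=> [i j|t p|B].
- pose h (p : {ffun ksubset m k -> F}) := \sum_S' l i j S' * p S'.
  apply: (@homogfun_ext _ _ _ _ _ _ h) => // [p|]; first by rewrite mxE.
  apply: homogfun_sum => S' _ _; apply: homogfunZ.
  by apply: homogfun_ext (homogfun_coord _ _ S') => // -[].
- apply/matrixP => i j; rewrite !mxE big_distrr /=.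
  by apply: eq_bigr => S' _; rewrite ffunE mulrCA.
apply/matrixP => i j; rewrite mxE -lP.
have := det_col_replace (colsub (kelem S) B) (col j B) i.
have -> : (\adj (colsub (kelem S) B) *m col j B) i 0 =
    (\adj (colsub (kelem S) B) *m B) i j.
  by rewrite !mxE; apply: eq_bigr => t _; rewrite !mxE.
move=> ->; congr (\det _); apply/matrixP => s t; rewrite !mxE /g.
by case: eqP.
Qed.

Lemma pl_neq0 B : row_free B -> exists S, pl B S != 0.
Proof.
move=> fB; have fT : row_full B^T by rewrite /row_full mxrank_tr.
have [l El] := det_colsub (fullrankfun fT).
have : \det (colsub (fullrankfun fT) B) != 0.
  rewrite -unitfE -unitmxE -unitmx_tr trmx_mxsub -row_full_unit.
  exact: fullrowsub_full.
rewrite El => H; apply/existsP; apply: contraNT H => /existsPn H.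
by rewrite big1 // => S _; have := H S; rewrite negbK => /eqP->; rewrite mulr0.
Qed.

Lemma pl_sub B B' t : t != 0 -> row_free B ->
  pl B' = [ffun S => t * pl B S] -> (B <= B')%MS.
Proof.
move=> t0 /pl_neq0[S BS] e.
have [E [_ EZ EB]] := plucker_echelon S.
have := EB B'; rewrite e EZ EB; move: BS; rewrite ffunE.
set N := colsub _ B => dN /(congr1 (fun Q => (t^-1 * (\det N)^-1) *: (N *m Q))) /=.
rewrite -scalemxAr mulmxA mul_mx_adj mul_scalar_mx !scalerA.
set z := (X in X *: B = _); have -> : z = 1 by rewrite /z; field; rewrite ?t0 ?dN.
rewrite scale1r => ->.
by rewrite !mulmxA scalemxAl submxMl.
Qed.

End Pluecker.

(** Lagrange reduction. A vector v with v G v^T = a nonzero exists by polarisation; subtracting the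
    rank-one matrix (G v^T)(v G) / a puts v into the kernel and so lowers the rank. A square root of
    a turns the subtracted matrix into w w^T. *)
Lemma symmetric_factor (F : numClosedFieldType) m r (G : 'M[F]_m) :
  G^T = G -> (\rank G <= r)%N -> exists D : 'M[F]_(m, r), G = D *m D^T.
Proof.
elim: r G => [|r IH] G sG rG.
  exists 0; rewrite mul0mx; apply/eqP; rewrite -mxrank_eq0 -leqn0 //.
have [->|G0] := eqVneq G 0; first by exists 0; rewrite mul0mx.
have [v va] : exists v : 'rV_m, (v *m G *m v^T) 0 0 != 0.
  apply: contrapT => nv.
  have z (v : 'rV_m) : v *m G *m v^T = 0.
    apply/matrixP => i j; rewrite !ord1 [RHS]mxE; apply/eqP/negPn/negP => h.
    by apply: nv; exists v.
  case/eqP: G0; apply/matrixP => i j; rewrite [RHS]mxE.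
  have := z (delta_mx 0 i + delta_mx 0 j).
  rewrite linearD /= !mulmxDl !mulmxDr !z addr0 add0r.
  rewrite !trmx_delta -!rowE -!colE => /matrixP/(_ 0 0); rewrite !mxE.
  have -> : G j i = G i j by rewrite -[in LHS]sG mxE.
  by rewrite -mulr2n => /eqP; rewrite mulrn_eq0 /= => /eqP.
set a := _ 0 0 in va.
have aE : v *m G *m v^T = a%:M by rewrite [LHS]mx11_scalar.
pose G' := G - a^-1 *: ((G *m v^T) *m (v *m G)).
have sG' : G'^T = G'.
  by rewrite /G' linearB linearZ /= !trmx_mul sG trmxK.
have G'G : (G' <= G)%MS.
  have -> : G' = (1%:M - a^-1 *: (G *m v^T *m v)) *m G.
    by rewrite mulmxBl mul1mx -scalemxAl -[X in _ = _ - _ *: X]mulmxA.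
  exact: submxMl.
have G'v : G' *m v^T = 0.
  rewrite mulmxBl -scalemxAl -(mulmxA (G *m v^T)) aE mul_mx_scalar scalerA mulVf //.
  by rewrite scale1r subrr.
have lt : (G' < G)%MS.
  rewrite /ltmx G'G; apply/negP => /submxP[Z eZ].
  case/eqP: va; rewrite /a -mulmxA eZ -(mulmxA Z) G'v !mulmx0 mxE //.
have rG' : (\rank G' <= r)%N.
  by move: lt; rewrite ltmxErank => /andP[_ lt]; rewrite -ltnS (leq_trans lt).
have [D eD] := IH G' sG' rG'.
pose w := (sqrtC a)^-1 *: (G *m v^T).
have ew : w *m w^T = a^-1 *: ((G *m v^T) *m (v *m G)).
  rewrite linearZ /= -scalemxAl -scalemxAr scalerA -expr2 exprVn sqrtCK.
  by rewrite trmx_mul trmxK sG.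
rewrite -addn1; exists (row_mx D w).
by rewrite tr_row_mx mul_row_col ew -eD subrK.
Qed.

(** This is x^2 + y^2 = (x + iy)(x - iy), applied to the two halves of the columns of a factor D
    with G = D D^T. The coordinates v A and v B of a vector v are then hyperbolic for G, as the
    spinor construction requires. *)
Lemma hyperbolic_factor (F : numClosedFieldType) n m (G : 'M[F]_m) :
  G^T = G -> m = (2 * n)%N ->
  exists A B : 'M[F]_(m, n), G = A *m B^T + B *m A^T.
Proof.
move=> sG em; have rG : (\rank G <= n + n)%N.
  by rewrite (leq_trans (rank_leq_row _)) // em mul2n addnn.
have [D ->] := symmetric_factor sG rG.
rewrite -[D]hsubmxK; move: (lsubmx D) (rsubmx D) => D1 D2.
exists (D1 + 'i *: D2), (2^-1 *: (D1 - 'i *: D2)).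
rewrite tr_row_mx mul_row_col.
have -> : (2^-1 *: (D1 - 'i *: D2))^T = 2^-1 *: (D1^T - 'i *: D2^T).
  by apply/matrixP => i j; rewrite !mxE.
have -> : (D1 + 'i *: D2)^T = D1^T + 'i *: D2^T by apply/matrixP => i j; rewrite !mxE.
rewrite -scalemxAr -scalemxAl -scalerDr.
rewrite !mulmxDl !mulmxDr !mulNmx !mulmxN -!scalemxAl -!scalemxAr !scalerA.
rewrite -expr2 sqrCi !scaleN1r !opprK.
set P := D1 *m D1^T; set Q := D2 *m D2^T.
set U := _ *: (D1 *m D2^T); set V := _ *: (D2 *m D1^T).
have -> : P - U + (V + Q) + (P + U + (- V + Q)) = 2 *: (P + Q).
  rewrite scaler_nat mulr2n.
  rewrite [V + Q]addrC [- V + Q]addrC !addrA [LHS]addrC.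
  rewrite !addrA; apply/eqP; rewrite -subr_eq0; apply/eqP/matrixP => i j.
  rewrite !mxE; ring.
by rewrite scalerA mulVf ?pnatr_eq0 // scale1r.
Qed.

(** * The spinor representation *)

Notation "I +e j" := (cube_add I j) (at level 50, left associativity).

Section Cube.
Variable n : nat.
Implicit Types (I J : cube n) (j k : 'I_n).

Lemma cube_addE I j i : (I +e j) i = I i (+) (i == j).
Proof. by rewrite ffunE. Qed.

Lemma cube_addK I j : I +e j +e j = I.
Proof. by apply/ffunP => i; rewrite !cube_addE -addbA addbb addbF. Qed.

Lemma cube_addC I j k : I +e j +e k = I +e k +e j.
Proof. by apply/ffunP => i; rewrite !cube_addE addbAC. Qed.

Lemma parity_add I j : parity (I +e j) = ~~ parity I.
Proof.
have pE J : parity J = \big[addb/false]_i J i.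
  by rewrite /parity (big_morph odd oddD (erefl _)); apply: eq_bigr => i _; rewrite oddb.
rewrite !pE (bigD1 j) //= [in RHS](bigD1 j) //= cube_addE eqxx addbT addNb.
congr (~~ (_ (+) _)); apply: eq_bigr => i /negPf ij.
by rewrite cube_addE ij addbF.
Qed.

Lemma weight_add I j : I j = false -> (\sum_i (I +e j) i = (\sum_i I i).+1)%N.
Proof.
move=> Ij; rewrite (bigD1 j) //= [in RHS](bigD1 j) //= cube_addE Ij eqxx /=.
rewrite add0n add1n; congr _.+1.
by apply: eq_bigr => t /negPf tj; rewrite cube_addE tj addbF.
Qed.

End Cube.

(** * The Clifford action, and the spinors killed by an isotropic space *)

Section Clifford.
Variables (F : numClosedFieldType) (n m : nat) (A B : 'M[F]_(m, n)).
Local Notation G := (A *m B^T + B *m A^T).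
Local Notation spin := {ffun cube n -> F^o}.
Implicit Types (I J : cube n) (j : 'I_n) (u v w : 'rV[F]_m) (y : spin).

(** The sign of moving e_j past the earlier factors of a basis monomial of the exterior algebra; it
    makes the operators for distinct indices anticommute. *)
Definition csign j I : F := \prod_(i < n | (i < j)%N) (-1) ^+ I i.

Lemma csign_add j (k : 'I_n) I : csign j (I +e k) = (-1) ^+ (k < j)%N * csign j I.
Proof.
rewrite /csign; case: (ltnP k j) => kj.
  rewrite (bigD1 k) //= [in RHS](bigD1 k) //= cube_addE eqxx addbT mulrA.
  congr (_ * _); first by case: (I k); rewrite ?mulrN1 ?opprK ?mulr1.
  by apply: eq_bigr => i /andP[_ /negPf ik]; rewrite cube_addE ik addbF.
rewrite mul1r; apply: eq_bigr => i ij; rewrite cube_addE.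
have /negPf -> : i != k by apply: contraTneq ij => ->; rewrite -leqNgt.
by rewrite addbF.
Qed.

Lemma csign_sqr j I : csign j I * csign j I = 1.
Proof.
rewrite /csign -big_split /= big1 // => i _.
by rewrite -expr2 sqrr_sign.
Qed.

Lemma csign_neq0 j I : csign j I != 0.
Proof.
apply/eqP => s; have := csign_sqr j I.
by rewrite s mul0r => /esym/eqP; rewrite oner_eq0.
Qed.

Definition ccoef v (b : bool) j : F := if b then (v *m A) 0 j else (v *m B) 0 j.

(** The exterior algebra model of spinors: the coordinates of v A act by wedging with e_j, those of
    v B by contracting with e_j. *)
Definition gam v y : spin :=
  [ffun I : cube n => \sum_j ccoef v (I j) j * csign j I * y (I +e j)].

Definition bform u v : F := (u *m G *m v^T) 0 0.

Lemma ccoefE v b j : ccoef v b j = (v *m (if b then A else B)) 0 j.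
Proof. by case: b. Qed.

Lemma ccoefD a u v b j : ccoef (a *: u + v) b j = a * ccoef u b j + ccoef v b j.
Proof. by rewrite /ccoef; case: b; rewrite mulmxDl -scalemxAl !mxE. Qed.

Lemma bformE u v :
  bform u v = \sum_j (ccoef u true j * ccoef v false j + ccoef u false j * ccoef v true j).
Proof.
rewrite /bform mulmxDr mulmxDl !mulmxA -!(mulmxA _ _ v^T) -!trmx_mul mxE big_split /=.
by congr (_ + _); rewrite mxE; apply: eq_bigr => j _; rewrite !mxE.
Qed.

Lemma bformC u v : bform u v = bform v u.
Proof.
rewrite !bformE; apply: eq_bigr => j _; rewrite addrC.
by congr (_ + _); rewrite mulrC.
Qed.

Lemma bformDl a u v w : bform (a *: u + v) w = a * bform u w + bform v w.
Proof. by rewrite /bform !mulmxDl -!scalemxAl !mxE. Qed.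

Lemma bformZBl a u c v d w z :
  bform (a *: (c *: u - d *: v) + w) z
  = a * (c * bform u z - d * bform v z) + bform w z.
Proof.
rewrite bformDl -scaleNr -[(- d) *: v]addr0 !bformDl.
by rewrite [bform 0 z]/bform !mul0mx mxE addr0 mulNr.
Qed.

Lemma gam_linear v : linear (gam v).
Proof.
move=> a y z; apply/ffunP => I; rewrite !ffunE.
rewrite scaler_sumr -big_split /=; apply: eq_bigr => j _.
by rewrite !ffunE mulrDr; congr (_ + _); exact: mulrCA.
Qed.

HB.instance Definition _ v :=
  GRing.isLinear.Build F spin spin _ (gam v) (gam_linear v).

Lemma gamDv a u v y : gam (a *: u + v) y = a *: gam u y + gam v y.
Proof.
apply/ffunP => I; rewrite !ffunE scaler_sumr -big_split /=.
apply: eq_bigr => j _; rewrite ccoefD !mulrDl; congr (_ + _).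
by rewrite -!mulrA.
Qed.

Lemma gam0v y : gam 0 y = 0.
Proof.
have := gamDv 1 0 0 y; rewrite scaler0 add0r scale1r => /eqP.
by rewrite -subr_eq subrr eq_sym => /eqP.
Qed.

Lemma gam_sum k (W : 'M[F]_(k, m)) (u : 'rV_k) y :
  gam (u *m W) y = \sum_i u 0 i *: gam (row i W) y.
Proof.
rewrite mulmx_sum_row; elim/big_rec2: _ => [|i x v _ <-]; first exact: gam0v.
exact: gamDv.
Qed.

Lemma clifford u v y : gam u (gam v y) + gam v (gam u y) = bform u v *: y.
Proof.
apply/ffunP => I.
pose t u v j k := ccoef u (I j) j * csign j I *
  (ccoef v ((I +e j) k) k * csign k (I +e j) * y (I +e j +e k)).
have gE u' v' : gam u' (gam v' y) I = \sum_j \sum_k t u' v' j k.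
  by rewrite ffunE; apply: eq_bigr => j _; rewrite ffunE big_distrr.
(* Exchanging the second double sum aligns the two orders of applying a pair of indices. For j and k
   distinct the terms cancel, since exactly one of the two signs flips; the diagonal terms add up to
   [bform u v]. *)
rewrite ffunE !gE [X in _ + X]exchange_big -big_split /= ffunE bformE.
rewrite scaler_suml; apply: eq_bigr => j _; rewrite -big_split /=.
rewrite (bigD1 j) //= big1 ?addr0 => [|k kj]; rewrite /t !cube_addE ?eqxx ?addbT.
  rewrite !csign_add ltnn !mul1r cube_addK.
  have /= s := csign_sqr j I.
  have scE (a : F) (b : F^o) : a *: b = a * b :> F by [].
  rewrite scE -[RHS]mulr1 -s; move: (y I : F) => yI; case: (I j) => /=; ring.
rewrite (negPf kj) eq_sym (negPf kj) !addbF !csign_add (cube_addC I j k).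
have : (j < k)%N = ~~ (k < j)%N by move: kj; rewrite -val_eqE /=; lia.
by move=> ->; move: (y _ : F) => yI; case: (k < j)%N => /=; rewrite ?expr1 ?expr0; ring.
Qed.

Definition ppart (b : bool) y : spin :=
  [ffun I : cube n => if parity I == b then y I else 0].

Lemma ppart_linear b : linear (ppart b).
Proof.
move=> a y z; apply/ffunP => I; rewrite !ffunE; case: ifP => // _.
by rewrite scaler0 addr0.
Qed.

HB.instance Definition _ b :=
  GRing.isLinear.Build F spin spin _ (ppart b) (ppart_linear b).

Lemma ppart_split y : y = ppart false y + ppart true y.
Proof.
by apply/ffunP => I; rewrite !ffunE; case: (parity I); rewrite /= ?addr0 ?add0r.
Qed.

Lemma ppart_id b y : ppart b (ppart b y) = ppart b y.
Proof. by apply/ffunP => I; rewrite !ffunE; case: ifP => // ->. Qed.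

Lemma ppart_neg b y : ppart (~~ b) (ppart b y) = 0.
Proof.
by apply/ffunP => I; rewrite !ffunE; case: (parity I); case: b.
Qed.

Lemma ppart_gam b v y : ppart b (gam v y) = gam v (ppart (~~ b) y).
Proof.
apply/ffunP => I; rewrite !ffunE; case: ifP => pI.
  apply: eq_bigr => j _; rewrite ffunE parity_add (eqP pI) eqxx //.
rewrite big1 // => j _; rewrite ffunE parity_add.
by case: (parity I) (b) pI => [] []; rewrite //= mulr0.
Qed.

Definition killed k (W : 'M[F]_(k, m)) y : Prop := forall i, gam (row i W) y = 0.

Lemma killed_sub k k' (W : 'M[F]_(k, m)) (W' : 'M[F]_(k', m)) y :
  (W' <= W)%MS -> killed W y -> killed W' y.
Proof.
move=> /submxP[Z ->] kW i; rewrite row_mul gam_sum big1 // => t _.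
by rewrite kW scaler0.
Qed.

Lemma killed_row k (W : 'M[F]_(k, m)) y v : (v <= W)%MS -> killed W y -> gam v y = 0.
Proof.
by move=> sv /(killed_sub sv)/(_ 0); rewrite row_id.
Qed.

Lemma killed_ppart k (W : 'M[F]_(k, m)) y b : killed W y -> killed W (ppart b y).
Proof. by move=> kW i; rewrite -{1}[b]negbK -ppart_gam kW linear0. Qed.

Lemma killed_gam k (W : 'M[F]_(k, m)) y v : W *m G *m v^T = 0 ->
  killed W y -> killed W (gam v y).
Proof.
move=> Wv kW i; have := clifford (row i W) v y.
rewrite kW linear0 addr0 /bform -!row_mul Wv row0 mxE scale0r.
exact.
Qed.

Lemma killed_isotropic k (W : 'M[F]_(k, m)) y : y != 0 -> killed W y ->
  W *m G *m W^T = 0.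
Proof.
move=> y0 kW; apply/matrixP => i j; have := clifford (row i W) (row j W) y.
rewrite !kW !linear0 addr0 => /eqP; rewrite eq_sym scaler_eq0 (negPf y0) orbF.
move=> /eqP e; rewrite [RHS]mxE -[RHS]e /bform -row_mul tr_row !mxE.
by apply: eq_bigr => t _; rewrite !mxE.
Qed.

Definition annsp k (W : 'M[F]_(k, m)) : {vspace spin} :=
  (\bigcap_i lker (linfun (gam (row i W))))%VS.

Lemma annspP k (W : 'M[F]_(k, m)) y : y \in annsp W <-> killed W y.
Proof.
rewrite /annsp memvE; split=> [/subv_bigcapP h i|h].
  by have := h i isT; rewrite -memvE memv_ker lfunE => /eqP.
by apply/subv_bigcapP => i _; rewrite -memvE memv_ker lfunE /= h.
Qed.

Hypothesis uG : G \in unitmx.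

(** Induction on k, splitting off the first row w of W. On the spinors killed by the other rows,
    [gam w] has square zero, and [gam w'] is a contracting homotopy for it when w' pairs to 1 with w
    and to 0 with the other rows. So kernel and image of [gam w] coincide, and the dimension
    halves. *)
Lemma dim_annsp k (W : 'M[F]_(k, m)) : row_free W -> W *m G *m W^T = 0 ->
  (\dim (annsp W) * 2 ^ k = 2 ^ n)%N.
Proof.
elim: k W => [|k IH] W fW iW.
  rewrite muln1 /annsp big_ord0 dimvf /dim /= card_ffun card_bool card_ord.
  by rewrite muln1.
pose w := @usubmx _ 1 k m W; pose W0 := @dsubmx _ 1 k m W.
have eW : W = col_mx w W0 by rewrite vsubmxK.
have wW : (w <= W)%MS by rewrite eW -(addsmxE w W0) addsmxSl.
have W0W : (W0 <= W)%MS by rewrite eW -(addsmxE w W0) addsmxSr.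
have iso a b (P : 'M_(a, m)) (Q : 'M_(b, m)) : (P <= W)%MS -> (Q <= W)%MS ->
    P *m G *m Q^T = 0.
  move=> /submxP[Z ->] /submxP[Y ->]; rewrite trmx_mul !mulmxA.
  by rewrite -(mulmxA Z) -(mulmxA Z) iW mulmx0 mul0mx.
have fW0 : row_free W0.
  apply: row_free0P => u u0.
  have : (row_mx (0 : 'M_1) u : 'rV_(1 + k)) *m (W : 'M_(1 + k, m)) = 0.
    by rewrite eW (@mul_row_col _ 1 1 k) mul0mx add0r.
  by move/(row_free_mul0 fW)/eqP; rewrite (@row_mx_eq0 _ 1 1 k) => /andP[_ /eqP].
have {IH} IH := IH W0 fW0 (iso _ _ _ _ W0W W0W).
have fWG : row_free (W *m G) by rewrite /row_free mxrankMfree ?row_free_unit.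
(* The rows of [W *m G] are independent, so the pairings of w' with the rows of W can be
   prescribed. *)
pose w' := (pinvmx (W *m G) *m delta_mx 0 0 : 'cV_m)^T.
have ew' : W *m G *m w'^T = delta_mx 0 0 by rewrite trmxK mulmxA mulmxVp // mul1mx.
have [ww' W0w'] : w *m G *m w'^T = 1%:M /\ W0 *m G *m w'^T = 0.
  split; first by rewrite /w !mul_usub_mx ew'; apply/matrixP => i j; rewrite !mxE !ord1.
  by rewrite /W0 !mul_dsub_mx ew'; apply/matrixP => i j; rewrite !mxE.
pose f := linfun (gam w).
have annE : annsp W = (annsp W0 :&: lker f)%VS.
  apply/vspaceP => y; rewrite memv_cap memv_ker lfunE /=; apply/idP/andP.
    move/annspP => kW; split; last by rewrite (killed_row wW kW).
    by apply/annspP; apply: killed_sub kW.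
  case=> /annspP kW0 /eqP kw; apply/annspP => i.
  have -> : row i W = row i (col_mx w W0) by rewrite -eW.
  case: (@split_ordP 1 k i) => j ->.
    by rewrite (@rowKu _ 1 k) ord1 row_id.
  by rewrite (@rowKd _ 1 k).
have imE : (f @: annsp W0 = annsp W0 :&: lker f)%VS.
  apply/eqP; rewrite eqEsubv; apply/andP; split; apply/subvP => y.
    case/memv_imgP=> z /annspP kz ->; rewrite memv_cap memv_ker /f !lfunE /=.
    apply/andP; split; first by apply/annspP; apply: killed_gam => //; apply: iso.
    have := clifford w w z; rewrite /bform iso // mxE scale0r -mulr2n -scaler_nat.
    by move=> /eqP; rewrite scaler_eq0 pnatr_eq0.
  rewrite memv_cap memv_ker lfunE /= => /andP[/annspP ky /eqP wy].
  apply/memv_imgP; exists (gam w' y); first by apply/annspP; apply: killed_gam.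
  have := clifford w w' y; rewrite wy linear0 addr0 /bform ww' mxE scale1r lfunE.
  by [].
have := limg_ker_dim f (annsp W0); rewrite imE -annE => e.
by rewrite -IH -e addnn -mul2n expnS mulnCA mulnA.
Qed.

Lemma isotropic_dim_le k (W : 'M[F]_(k, m)) :
  row_free W -> W *m G *m W^T = 0 -> (k <= n)%N.
Proof.
move=> fW iW; have := dim_annsp fW iW; case: (\dim _) => [|d] e.
  by have := expn_gt0 2 n; rewrite -e.
by rewrite -(@leq_exp2l 2) // -e leq_pmull.
Qed.

(** For k = n the annihilator is a line, which cannot contain the nonzero even part and the nonzero
    odd part of y at once. *)
Lemma killed_dim_lt k (W : 'M[F]_(k, m)) y : row_free W -> killed W y ->
  (forall b, ppart b y != 0) -> (k < n)%N.
Proof.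
move=> fW kW yb; have y0 : y != 0.
  by apply: contraNneq (yb true) => ->; rewrite linear0.
have iW := killed_isotropic y0 kW.
have := isotropic_dim_le fW iW; rewrite leq_eqVlt => /orP[/eqP ek|//].
have d1 : \dim (annsp W) = 1%N.
  have := dim_annsp fW iW; have -> : (2 ^ n = 1 * 2 ^ k)%N by rewrite ek mul1n.
  by move/eqP; rewrite eqn_pmul2r ?expn_gt0 // => /eqP.
have t : ppart true y \in annsp W by apply/annspP; apply: killed_ppart.
have f : ppart false y \in annsp W by apply/annspP; apply: killed_ppart.
have e : annsp W = <[ppart true y]>%VS.
  by apply/eqP; rewrite eq_sym eqEdim -memvE t dim_vline yb d1.
move: f; rewrite e => /vlineP[a ea].
have := yb false; rewrite -ppart_id ea linearZ /= (ppart_neg true) scaler0 eqxx.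
by [].
Qed.

Hypothesis n0 : (0 < n)%N.

Lemma dim_annsp2 (W : 'M[F]_(n - 1, m)) : row_free W -> W *m G *m W^T = 0 ->
  \dim (annsp W) = 2%N.
Proof.
move=> fW iW; have := dim_annsp fW iW.
have -> : (2 ^ n = 2 * 2 ^ (n - 1))%N by rewrite -expnS subn1 prednK.
by move/eqP; rewrite eqn_pmul2r ?expn_gt0 // => /eqP.
Qed.

Hypothesis em : m = (2 * n)%N.

(** Suppose that every spinor killed by W has zero part of parity b, and let y be a nonzero one. For
    v orthogonal to W, [gam v y] is again killed by W and has parity b, so it vanishes. Then y is
    killed by the whole orthogonal space of W, which would be isotropic of dimension n + 1. *)
Lemma ann_ex (W : 'M[F]_(n - 1, m)) b : row_free W -> W *m G *m W^T = 0 ->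
  exists y, [/\ y != 0, ppart b y = y & killed W y].
Proof.
move=> fW iW.
have d2 := dim_annsp2 fW iW.
apply: contrapT => H.
have z y : killed W y -> ppart b y = 0.
  move=> ky; apply/eqP/negPn/negP => y0; apply: H; exists (ppart b y).
  by split=> //; [exact: ppart_id|exact: killed_ppart].
have [y y0 kW] : exists2 y, y != 0 & killed W y.
  exists (vpick (annsp W)); first by rewrite vpick0 -dimv_eq0 d2.
  by apply/annspP; apply: memv_pick.
pose Q := row_base (kermx (W *m G)^T).
have fQ : row_free Q by exact: row_base_free.
have rQ : \rank (kermx (W *m G)^T) = n.+1.
  rewrite mxrank_ker mxrank_tr mxrankMfree ?row_free_unit // (eqP fW) em; lia.
have Qu i : W *m G *m (row i Q)^T = 0.
  apply: trmx_inj; rewrite trmx_mul trmxK trmx0; apply/sub_kermxP.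
  by rewrite (submx_trans (row_sub _ _)) // eq_row_base.
have gz i : gam (row i Q) y = 0.
  have := z _ (killed_gam (Qu i) kW); rewrite ppart_gam.
  have := z y kW; have := ppart_split y; case: (b) => /= e0 e1.
    by rewrite [in X in _ -> X = _]e0 e1 addr0.
  by rewrite [in X in _ -> X = _]e0 e1 add0r.
have := isotropic_dim_le fQ (killed_isotropic y0 gz).
by rewrite rQ ltnn.
Qed.

Lemma ann_line (W : 'M[F]_(n - 1, m)) b : row_free W -> W *m G *m W^T = 0 ->
  exists y, [/\ y != 0, ppart b y = y, killed W y &
    forall z, killed W z -> exists t, ppart b z = t *: y].
Proof.
move=> fW iW.
have [y [y0 yb ky]] := ann_ex b fW iW.
have [y' [y'0 yb' ky']] := ann_ex (~~ b) fW iW.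
exists y; split=> // z kz.
have d2 := dim_annsp2 fW iW.
have by' : ppart b y' = 0 by rewrite -yb' -{1}[b]negbK ppart_neg.
have e : annsp W = (<[y]> + <[y']>)%VS.
  apply/eqP; rewrite eq_sym eqEdim; apply/andP; split.
    by rewrite subv_add -!memvE; apply/andP; split; apply/annspP.
  rewrite dimv_disjoint_sum ?dim_vline ?y0 ?y'0 ?d2 //.
  apply/eqP; rewrite -subv0; apply/subvP => x; rewrite memv_cap.
  case/andP=> /vlineP[a ea] /vlineP[c ec]; rewrite memv0.
  have : ppart b x = x by rewrite ea linearZ /= yb.
  by rewrite ec linearZ /= by' scaler0 => <-.
have : z \in annsp W by apply/annspP.
rewrite e => /memv_addP[u /vlineP[a ->] [u' /vlineP[c ->] ->]].
by exists a; rewrite linearD !linearZ /= by' scaler0 addr0 yb.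
Qed.

End Clifford.

(** * The cube recurrence and annihilators of spinors *)

Lemma sub_row_free (F : fieldType) a m k (K : 'M[F]_(a, m)) : (k <= \rank K)%N ->
  exists2 W : 'M[F]_(k, m), row_free W & (W <= K)%MS.
Proof.
move=> kK; exists (pid_mx k *m row_base K).
  by rewrite /row_free mxrankMfree ?row_base_free // rank_pid_mx.
by rewrite (submx_trans (submxMl _ _)) // eq_row_base.
Qed.

Section CubeRelation.
Variables (F : numClosedFieldType) (n m : nat) (A B : 'M[F]_(m, n)).
Local Notation G := (A *m B^T + B *m A^T).
Local Notation spin := {ffun cube n -> F^o}.
Local Notation gam := (gam A B).
Local Notation ccoef := (ccoef A B).
Local Notation killed := (killed A B).
Implicit Types (I J : cube n) (j k l : 'I_n) (v : 'rV[F]_m) (x y : spin).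

(** The cube relation with Clifford signs, for l in any position relative to j < k: the signs are
    the changes of [csign F l] along e_j and e_k. *)
Definition crel y I j k l : F :=
  (-1) ^+ (j < l)%N * (-1) ^+ (k < l)%N * (y I * y (I +e j +e k +e l))
  + (-1) ^+ (k < l)%N * (y (I +e j) * y (I +e k +e l))
  - (-1) ^+ (j < l)%N * (y (I +e k) * y (I +e j +e l))
  - y (I +e j +e k) * y (I +e l).

(** The bridge between cube relations and annihilators: on the left, the contributions of directions
    j and k cancel, and every other direction l contributes its coordinate of v times one cube
    relation. *)
Lemma crel_gam y v I j k : (j < k)%N -> I j = false -> I k = false ->
  y I * gam v y (I +e j +e k) + y (I +e j) * gam v y (I +e k)
    - y (I +e k) * gam v y (I +e j) - y (I +e j +e k) * gam v y I
  = \sum_(l | (l != j) && (l != k)) ccoef v (I l) l * csign F l I * crel y I j k l.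
Proof.
move=> jk Ij Ik; have kj : (k < j)%N = false by lia.
have njk : (j == k) = false by rewrite -val_eqE /=; lia.
have nkj : (k == j) = false by rewrite eq_sym.
rewrite !ffunE !big_distrr /= -big_split /= -!sumrB /=.
rewrite (bigD1 j) //= (bigD1 k) /=; last by rewrite nkj.
rewrite addrA [X in X + _](_ : _ = 0) ?add0r; last first.
  rewrite !csign_add !cube_addE !eqxx njk nkj !ltnn kj jk Ij Ik /=.
  rewrite !(cube_addC _ k j) !cube_addK.
  by rewrite ?expr0 ?expr1; ring.
apply: eq_bigr => l /andP[lj lk].
rewrite !csign_add !cube_addE (negPf lj) (negPf lk) !addbF /crel.
by ring.
Qed.

(** If the relation failed, n - 2 linear conditions would force a vector v of W to vanish: once the
    coordinates [ccoef v (I i) i] are zero for i other than k and l, [crel_gam] gives the one at l,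
    [gam v y I = 0] gives the one at k, and the values at [I +e i] give the complementary
    coordinates. This contradicts the dimension of W. *)
Lemma killed_crel (W : 'M[F]_(n - 1, m)) y I j k l : G \in unitmx ->
  (forall J, y J != 0) -> row_free W -> killed W y ->
  (j < k)%N -> I j = false -> I k = false -> l != j -> l != k ->
  crel y I j k l = 0.
Proof.
move=> uG y0 fW kW jk Ij Ik lj lk; apply/eqP/negPn/negP => R0.
have s0 i J : csign F i J != 0 := csign_neq0 _ _ _.
pose D := [set~ k] :\ l.
have cD : #|D| = (n - 2)%N.
  have := cardsC1 k; rewrite (cardsD1 l) card_ord !inE lk -/D => e.
  by move: e; rewrite add1n => e; rewrite -[#|D|]/((#|D|).+1.-1) e; lia.
pose Z := \matrix_(i < m, t < #|D|)
   ccoef (delta_mx 0 i) (I (enum_val t)) (enum_val t).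
have vZ v t : (v *m Z) 0 t = ccoef v (I (enum_val t)) (enum_val t).
  rewrite mxE /ccoef; case E: (I _); rewrite mxE; apply: eq_bigr => i _;
    by rewrite mxE /ccoef E -rowE mxE.
have inj (u : 'rV_(n - 1)) : u *m (W *m Z) = 0 -> u = 0.
  rewrite mulmxA => uz; apply: (row_free_mul0 fW); set v := u *m W.
  have kv : gam v y = 0 by apply: (killed_row _ kW); apply: submxMl.
  have cD0 i : i != k -> i != l -> ccoef v (I i) i = 0.
    move=> ik il; have iD : i \in D by rewrite !inE il ik.
    by have := vZ v (enum_rank_in iD i); rewrite enum_rankK_in // uz mxE.
  have cl : ccoef v (I l) l = 0.
    have := crel_gam y v jk Ij Ik; rewrite kv !ffunE !mulr0 !subr0 addr0.
    rewrite (bigD1 l) /=; last by rewrite lj.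
    rewrite big1 ?addr0 => [|i /andP[/andP[_ ik] il]].
      move/esym/eqP; rewrite !mulf_eq0 (negPf (s0 _ _)) (negPf R0) !orbF.
      by move/eqP.
    by rewrite cD0 // !mul0r.
  have ck : ccoef v (I k) k = 0.
    have : gam v y I = 0 by rewrite kv ffunE.
    rewrite ffunE (bigD1 k) //= big1 ?addr0 => [|i ik].
      move/eqP; rewrite !mulf_eq0 (negPf (s0 _ _)) (negPf (y0 _)) !orbF.
      by move/eqP.
    have [->|il] := eqVneq i l; first by rewrite cl !mul0r.
    by rewrite cD0 // !mul0r.
  have cI i : ccoef v (I i) i = 0.
    have [->//|ik] := eqVneq i k; have [->//|il] := eqVneq i l.
    exact: cD0.
  have cN i : ccoef v (~~ I i) i = 0.
    have : gam v y (I +e i) = 0 by rewrite kv ffunE.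
    rewrite ffunE (bigD1 i) //= big1 ?addr0 => [|i' ii'].
      rewrite cube_addE eqxx addbT => /eqP.
      by rewrite !mulf_eq0 (negPf (s0 _ _)) (negPf (y0 _)) !orbF => /eqP.
    by rewrite cube_addE (negPf ii') addbF cI !mul0r.
  have call b i : ccoef v b i = 0.
    by have := cI i; have := cN i; case: (I i); case: b.
  have vA : v *m A = 0 by apply/rowP => i; rewrite [RHS]mxE; exact: (call true i).
  have vB : v *m B = 0 by apply/rowP => i; rewrite [RHS]mxE; exact: (call false i).
  apply: (@row_free_mul0 _ _ _ _ G); first by rewrite row_free_unit.
  by rewrite mulmxDr !mulmxA vA vB !mul0mx addr0.
have := row_free0P inj; rewrite -row_leq_rank => r1.
have := leq_trans r1 (leq_trans (mxrankM_maxr _ _) (rank_leq_col _)).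
(* The indices j < k < n give n at least 2, so the truncated subtractions n - 1 and n - 2 are
   genuine. *)
by rewrite cD; have := ltn_ord k; have := ltn_ord j; lia.
Qed.

(** W is cut out by the n + 1 equations [gam v y = 0] at the origin and at its neighbours. At a
    vertex of larger weight, two nonzero coordinates span a 2-face whose other vertices are lighter;
    [crel_gam] with zero right-hand side then propagates the vanishing, since y has no zero
    coordinate. *)
Lemma crel_killed y : m = (2 * n)%N ->
  (forall J, y J != 0) ->
  (forall I j k l, (j < k)%N -> I j = false -> I k = false -> l != j -> l != k ->
     crel y I j k l = 0) ->
  exists2 W : 'M[F]_(n - 1, m), row_free W & killed W y.
Proof.
move=> em y0 R0; pose z : cube n := [ffun=> false].
pose C : 'M[F]_(m, 1 + n) := row_mx (\col_i gam (delta_mx 0 i) y z)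
                 (\matrix_(i < m, j < n) gam (delta_mx 0 i) y (z +e j)).
have rC : (n - 1 <= \rank (kermx C))%N.
  by rewrite mxrank_ker; have := rank_leq_col C; move: (\rank C) => r; lia.
have [W fW WC] := sub_row_free rC; exists W => // i; set v := row i W.
have vC : v *m C = 0.
  by apply/sub_kermxP; rewrite (submx_trans (row_sub _ _)).
have gE J : gam v y J = \sum_i v 0 i * gam (delta_mx 0 i) y J.
  have := @gam_sum _ _ _ A B _ 1%:M v y; rewrite mulmx1 => ->.
  by rewrite sum_ffunE; apply: eq_bigr => t _; rewrite !ffunE row1.
move: vC; rewrite mul_mx_row => /eqP; rewrite row_mx_eq0 => /andP[/eqP v0 /eqP v1].
have p0 : gam v y z = 0.
  have := congr1 (fun Q : 'M[F]_1 => Q 0 0) v0; rewrite !mxE => e.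
  by rewrite gE -[RHS]e; apply: eq_bigr => t _; congr (_ * _); rewrite mxE.
have p1 j : gam v y (z +e j) = 0.
  have := congr1 (fun Q : 'rV[F]_n => Q 0 j) v1; rewrite !mxE => e.
  by rewrite gE -[RHS]e; apply: eq_bigr => t _; congr (_ * _); rewrite mxE.
apply/ffunP => I; rewrite [RHS]ffunE.
pose wt J := (\sum_j J j)%N.
have wtD J j : J j = true -> (wt (J +e j)).+1 = wt J.
  move=> Jj; have := @weight_add _ (J +e j) j.
  by rewrite cube_addK cube_addE Jj eqxx => /(_ erefl).
have [w] := ubnP (wt I); elim: w I => // w IH I wI.
case: (boolP [exists j : 'I_n, exists k : 'I_n, [&& (j < k)%N, I j & I k]]).
  case/existsP=> j /existsP[k] /and3P[jk Ij Ik]; pose J := I +e j +e k.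
  have kj : (k == j) = false by rewrite -val_eqE /=; lia.
  have Jj : J j = false by rewrite !cube_addE Ij eqxx eq_sym kj.
  have Jk : J k = false by rewrite !cube_addE Ik eqxx kj.
  have Ij1 := wtD _ _ Ij; have Ik1 := wtD _ _ Ik.
  have Ijk : (I +e j) k = true by rewrite cube_addE Ik kj.
  have Ijk1 := wtD _ _ Ijk.
  have eJj : J +e j = I +e k by rewrite /J cube_addC cube_addK.
  have eJk : J +e k = I +e j by rewrite /J cube_addK.
  have eJjk : J +e j +e k = I by rewrite eJj cube_addK.
  have := crel_gam y v jk Jj Jk; rewrite eJjk eJj eJk.
  rewrite (IH (I +e j)) ?(IH (I +e k)) ?(IH J) ?mulr0 ?subr0 ?addr0;
    try by rewrite /J; lia.
  rewrite big1 => [|l /andP[lj lk]]; last by rewrite R0 ?mulr0.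
  by move/eqP; rewrite mulf_eq0 (negPf (y0 _)) => /eqP.
move/existsPn => H; case: (boolP [exists j, I j]) => [/existsP[j Ij]|/existsPn Hz].
  have -> : I = z +e j; last exact: p1.
  apply/ffunP => k; rewrite !ffunE; have [->|kj] := eqVneq k j; first by rewrite Ij.
  apply/negbTE/negP => Ik.
  have : (j < k)%N || (k < j)%N by move: kj; rewrite -val_eqE /=; lia.
  case/orP=> jk.
    by have := H j; rewrite negb_exists => /forallP/(_ k); rewrite jk Ij Ik.
  by have := H k; rewrite negb_exists => /forallP/(_ j); rewrite jk Ij Ik.
have -> : I = z; last exact: p0.
by apply/ffunP => k; rewrite !ffunE; apply/negbTE.
Qed.

(* The sign turning the cube recurrence into the relation [crel], whose signs are
   those of the Clifford action. *)
Definition tw I : bool := ((\sum_i I i) %% 4 == 3)%N.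

Definition twist x : spin := [ffun I : cube n => (-1) ^+ tw I * (x I : F)].

Lemma twistK : involutive twist.
Proof. by move=> x; apply/ffunP => I; rewrite !ffunE signrMK. Qed.

Lemma twist_neq0 x I : (twist x I != 0) = (x I != 0).
Proof. by rewrite ffunE mulf_eq0 signr_eq0. Qed.

Lemma crel_twist x I (a b c : 'I_n) : (a < b)%N -> (b < c)%N ->
  I a = false -> I b = false -> I c = false ->
  crel (twist x) I a b c = (-1) ^+ tw I * (-1) ^+ tw (I +e a +e b +e c) *
   (x I * x (I +e a +e b +e c) + x (I +e a +e b) * x (I +e c)
    + x (I +e b +e c) * x (I +e a) - x (I +e a +e c) * x (I +e b)).
Proof.
move=> ab bc Ia Ib Ic; have ac := ltn_trans ab bc.
have nab : (b == a) = false by rewrite -val_eqE /=; lia.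
have nac : (c == a) = false by rewrite -val_eqE /=; lia.
have nbc : (c == b) = false by rewrite -val_eqE /=; lia.
pose wt J := (\sum_j J j)%N.
have wtD J j : J j = false -> wt (J +e j) = (wt J).+1 := @weight_add _ J j.
pose tau w : F := (-1) ^+ (w %% 4 == 3)%N.
have tE J : (-1) ^+ tw J = tau (wt J) by [].
(* The identity that dictates [tw]: in a 3-cube the antipodal pair of weights w, w + 3 and the three
   pairs of weights w + 1, w + 2 must acquire opposite signs. *)
have tauS w : tau w * tau w.+3 = - (tau w.+1 * tau w.+2).
  rewrite /tau -!signr_addb -signrN; congr (_ ^+ _).
  have : (w %% 4 < 4)%N by rewrite ltn_mod.
  rewrite -[w.+3]addn3 -[w.+2]addn2 -[w.+1]addn1.
  rewrite -(modnDml w 3) -(modnDml w 2) -(modnDml w 1).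
  by case: (w %% 4)%N => [|[|[|[|]]]].
rewrite /crel bc ac !ffunE !tE.
rewrite !wtD ?cube_addE ?Ia ?Ib ?Ic ?nab ?nac ?nbc //.
move: (tauS (wt I)); move: (tau _) (tau _) (tau _) (tau _) => t0 t3 t1 t2 e.
rewrite ?expr1.
apply/eqP; rewrite -subr_eq0; apply/eqP.
transitivity ((t2 * t1 + t3 * t0) * (x (I +e a +e c) * x (I +e b)
  - x (I +e a +e b) * x (I +e c) - x (I +e b +e c) * x (I +e a))); first by ring.
by rewrite e addNr mul0r.
Qed.

(** Together with [crel_sort], this reduces a relation with l anywhere and with either value of
    [I l] to one with increasing indices, based at the lowest vertex. *)
Lemma crel_toggle y I j k l :
  crel y (I +e l) j k l = - ((-1) ^+ (j < l)%N * (-1) ^+ (k < l)%N) * crel y I j k l.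
Proof.
rewrite /crel cube_addK.
have -> : I +e l +e j +e k +e l = I +e j +e k.
  by rewrite !(cube_addC _ l) cube_addK.
have -> : I +e l +e k +e l = I +e k by rewrite (cube_addC _ l) cube_addK.
have -> : I +e l +e j +e l = I +e j by rewrite (cube_addC _ l) cube_addK.
have -> : I +e l +e j +e k = I +e j +e k +e l by rewrite !(cube_addC _ l).
rewrite !(cube_addC _ l).
by case: (j < l)%N; case: (k < l)%N; rewrite /= ?expr0 ?expr1; ring.
Qed.

Lemma crel_sort y I j k l : (j < k)%N -> (l < k)%N -> l != j ->
  crel y I j k l = (-1) ^+ (j < l)%N *
    crel y I (if (j < l)%N then j else l) (if (j < l)%N then l else j) k.
Proof.
move=> jk lk lj; rewrite /crel; have -> : (k < l)%N = false by lia.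
case: (ltnP j l) => jl; rewrite ?jk ?lk /= ?expr0 ?expr1.
  by rewrite (cube_addC (I +e j) l k) (cube_addC I l k); ring.
by rewrite !(cube_addC _ l); ring.
Qed.

Lemma Yring_crel x : Yring (x : {ffun cube n -> F}) <->
  (forall J, twist x J != 0) /\
  (forall I j k l, (j < k)%N -> I j = false -> I k = false -> l != j -> l != k ->
     crel (twist x) I j k l = 0).
Proof.
split=> [[x0 hx]|[x0 hx]]; last first.
  split=> [I|a b c I ab bc Ia Ib Ic]; first by rewrite -twist_neq0.
  have ac := ltn_trans ab bc.
  have := hx I a b c ab Ia Ib; rewrite -!val_eqE /= !gtn_eqF // => /(_ isT isT).
  rewrite crel_twist // => /eqP; rewrite !mulf_eq0 !signr_eq0 /= subr_eq0 => /eqP.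
  by move=> e; symmetry.
split=> [J|]; first by rewrite twist_neq0.
have sorted I (a b c : 'I_n) : (a < b)%N -> (b < c)%N ->
    I a = false -> I b = false -> I c = false -> crel (twist x) I a b c = 0.
  by move=> *; rewrite crel_twist // (hx a b c I) // subrr mulr0.
have noc I j k l : (j < k)%N -> I j = false -> I k = false -> I l = false ->
    l != j -> l != k -> crel (twist x) I j k l = 0.
  move=> jk Ij Ik Il lj lk; case: (ltnP k l) => kl; first exact: sorted.
  have {}lk : (l < k)%N by move: lk; rewrite -val_eqE /=; lia.
  rewrite crel_sort //; case: (ltnP j l) => jl; rewrite sorted ?mulr0 //.
  by move: lj; rewrite -val_eqE /=; lia.
move=> I j k l jk Ij Ik lj lk; case Il: (I l); last exact: noc.
rewrite -[I](cube_addK I l) crel_toggle noc ?mulr0 // cube_addE ?Ij ?Ik ?Il ?eqxx //.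
  by rewrite eq_sym (negPf lj).
by rewrite eq_sym (negPf lk).
Qed.

End CubeRelation.

(** * The closure of the cube recurrence variety *)

Lemma rank_mxsub (F : fieldType) a b s (M : 'M[F]_(a, b)) (f : 'I_s -> 'I_a)
    (g : 'I_s -> 'I_b) : (\rank (mxsub f g M) <= \rank M)%N.
Proof.
have -> : mxsub f g M = rowsub f 1%:M *m M *m colsub g 1%:M.
  rewrite mul_rowsub_mx mul1mx mulmx_colsub mulmx1.
  by apply/matrixP => i j; rewrite !mxE.
exact: leq_trans (mxrankM_maxl _ _) (mxrankM_maxr _ _).
Qed.

Lemma rank_le_minors (F : fieldType) a b r (M : 'M[F]_(a, b)) :
  (\rank M <= r)%N <->
  forall s (f : 'I_s -> 'I_a) (g : 'I_s -> 'I_b), (r < s)%N -> \det (mxsub f g M) = 0.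
Proof.
split=> [rM s f g rs|H].
  apply/eqP; apply: contraTT rs; rewrite -unitfE -unitmxE => /mxrank_unit e.
  by rewrite -leqNgt -e (leq_trans (rank_mxsub _ _ _)).
rewrite leqNgt; apply/negP => rM; pose f := maxrankfun M.
have fT : row_full (rowsub f M)^T by rewrite /row_full mxrank_tr; apply: maxrowsub_free.
have := H _ f (fullrankfun fT) rM; apply/eqP.
have -> : mxsub f (fullrankfun fT) M = (rowsub (fullrankfun fT) (rowsub f M)^T)^T.
  by apply/matrixP => i j; rewrite !mxE.
by rewrite det_tr -unitfE -unitmxE fullrowsub_unit.
Qed.

Lemma poly_all_roots_eq0 (F : numFieldType) (p : {poly F}) :
  (forall t, p.[t] = 0) -> p = 0.
Proof.
move=> H; apply/eqP/negPn/negP => p0.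
have := @max_poly_roots _ p [seq i%:R | i <- iota 0 (size p)] p0.
rewrite size_map size_iota ltnn => e; suff : false by [].
apply: e; first by apply/allP => t _; rewrite /root H.
by rewrite map_inj_uniq ?iota_uniq // => i j /eqP; rewrite eqr_nat => /eqP.
Qed.

Section SpinorVariety.
Variables (F : numClosedFieldType) (n m : nat) (A B : 'M[F]_(m, n)).
Local Notation G := (A *m B^T + B *m A^T).
Local Notation spin := {ffun cube n -> F^o}.
Local Notation gam := (gam A B).
Local Notation ccoef := (ccoef A B).
Local Notation killed := (killed A B).
Local Notation bform := (bform A B).
Hypothesis uG : G \in unitmx.
Hypothesis em : m = (2 * n)%N.
Hypothesis n0 : (0 < n)%N.
Implicit Types (I J : cube n) (u v : 'rV[F]_m) (x y : {ffun cube n -> F})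
  (p : multiproj F (@parity n)).

Definition spinor_variety : set (multiproj F (@parity n)) :=
  [set p | exists2 x : {ffun cube n -> F}, hcoords p x &
     exists2 W : 'M[F]_(n - 1, m), row_free W & killed W (twist x)].

(** Since [gam] exchanges parities, W kills the even and the odd part separately. So being killed by
    W depends only on the point of the product of projective spaces. *)
Lemma killed_scale k (W : 'M[F]_(k, m)) x x' (t : bool -> F) :
  (forall I, x' I = t (parity I) * x I) ->
  killed W (twist x) -> killed W (twist x').
Proof.
move=> e kW i.
have -> : twist x' = t false *: ppart false (twist x) + t true *: ppart true (twist x).
  apply/ffunP => I; rewrite !ffunE e; case: (parity I) => /=;
    rewrite scaler0 ?addr0 ?add0r; exact: mulrCA.
by rewrite linearD !linearZ /= !killed_ppart // !scaler0 addr0.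
Qed.

Lemma killed_hcoords k (W : 'M[F]_(k, m)) p x x' : hcoords p x -> hcoords p x' ->
  killed W (twist x) -> killed W (twist x').
Proof.
by move=> hx hx'; have [t _ e] := hcoords_scale hx hx'; exact: (killed_scale e).
Qed.

Definition gmx x : 'M[F]_(m, #|cube n|) :=
  \matrix_(i, t) gam (delta_mx 0 i) (twist x) (enum_val t).

Lemma gmxE x v t : (v *m gmx x) 0 t = gam v (twist x) (enum_val t).
Proof.
have := @gam_sum _ _ _ A B _ 1%:M v (twist x); rewrite mulmx1 => ->.
by rewrite mxE sum_ffunE; apply: eq_bigr => i _; rewrite [RHS]ffunE row1 mxE.
Qed.

Lemma killed_gmx k (W : 'M[F]_(k, m)) x : W *m gmx x = 0 <-> killed W (twist x).
Proof.
split=> [e i|kW].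
  apply/ffunP => I; rewrite -[I]enum_rankK -gmxE -row_mul e row0 mxE.
  by rewrite ffunE.
by apply/row_matrixP => i; apply/rowP => t; rewrite row_mul gmxE kW ffunE row0 mxE.
Qed.

(** The column at a vertex involves only coordinates of the opposite parity, so the degree depends
    on the column alone, as [homogfun_det] and [local_kernel] require. *)
Lemma gmx_homog i t :
  homogfun (@parity n) (fun b : bool => ~~ parity (enum_val t) == b) (fun x => gmx x i t).
Proof.
pose J := enum_val t.
pose h x := \sum_j ccoef (delta_mx 0 i) (J j) j * csign F j J
  * (-1) ^+ tw (J +e j) * x (J +e j).
apply: (@homogfun_ext _ _ _ _ _ _ h) => // [x|].
  by rewrite mxE ffunE; apply: eq_bigr => j _; rewrite ffunE -!mulrA.
apply: homogfun_sum => j _ _; apply: homogfunZ.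
by apply: homogfun_ext (homogfun_coord _ _ (J +e j)) => // b; rewrite parity_add.
Qed.

Lemma gmx_rank_le p x : hcoords p x ->
  spinor_variety p <-> (\rank (gmx x) <= n.+1)%N.
Proof.
move=> hx; split=> [[x' hx' [W fW kW]]|rx].
  have /killed_gmx/eqP := killed_hcoords hx' hx kW; rewrite -sub_kermx.
  by move/mxrankS; rewrite (eqP fW) mxrank_ker; have := rank_leq_row (gmx x); lia.
exists x => //; have [|W fW sW] := @sub_row_free _ _ _ (n - 1) (kermx (gmx x)).
  by rewrite mxrank_ker; lia.
by exists W => //; apply/killed_gmx; apply/sub_kermxP.
Qed.

Lemma hcoords_ppart p x : hcoords p x -> forall b, ppart b (twist x) != 0.
Proof.
move=> hx b; have [I pI xI] := hcoords_neq0 b hx.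
apply: contraNneq xI => /ffunP/(_ I); rewrite !ffunE pI eqxx => /eqP.
by rewrite mulf_eq0 signr_eq0.
Qed.

(** The rank cannot drop further because, by [killed_dim_lt], no n-dimensional space kills a spinor
    with both parts nonzero. Constancy of this rank is what [local_kernel] needs. *)
Lemma gmx_rank p x : hcoords p x -> spinor_variety p -> \rank (gmx x) = n.+1.
Proof.
move=> hx Xp; apply/eqP; rewrite eqn_leq; apply/andP; split.
  exact/(gmx_rank_le hx).
have [W fW sW] := @sub_row_free _ _ _ _ (kermx (gmx x)) (leqnn _).
have /killed_gmx kW : W *m gmx x = 0 by apply/sub_kermxP.
have := killed_dim_lt uG fW kW (hcoords_ppart hx).
by rewrite mxrank_ker; have := rank_leq_row (gmx x); lia.
Qed.

Lemma spinor_variety_closed : zclosed spinor_variety.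
Proof.
exists [set P | (exists d, multihomog (@parity n) d P) /\
  exists s (f : 'I_s -> 'I_m) (g : 'I_s -> 'I_#|cube n|),
   (n.+1 < s)%N /\ forall x, peval P x = \det (mxsub f g (gmx x))].
split=> [P []//|]; apply/seteqP; split=> p /= H.
  move=> P x [_ [s [f [g [ns ->]]]]] hx.
  by move/(gmx_rank_le hx)/rank_le_minors: H; apply.
have [x hx] := hcoords_ex p; apply/(gmx_rank_le hx)/rank_le_minors => s f g ns.
have [P hP eP] : homogfun (@parity n)
    (fun k => \sum_j (~~ parity (enum_val (g j)) == k))%N
    (fun x => \det (mxsub f g (gmx x))).
  apply: (@homogfun_det _ _ _ _ _ 
    (fun j (k : bool) => (~~ parity (enum_val (g j)) == k) : nat)).
  by move=> i j; apply: homogfun_ext (gmx_homog (f i) (g j)) => // z; rewrite [RHS]mxE.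
rewrite -eP; apply: H => //; split; first by eexists; exact: hP.
by exists s, f, g.
Qed.

(** [row_mx A B] is injective because G is, and square, so hyperbolic coordinates can be prescribed.
    For the resulting vector, [gam] is a single wedge or contraction. *)
Lemma basis_vector (b : bool) (a : 'I_n) :
  exists u, forall b' j, ccoef u b' j = ((b' == b) && (j == a))%:R.
Proof.
have fAB : row_free (row_mx A B).
  apply: row_free0P => u; rewrite mul_mx_row => /eqP.
  rewrite row_mx_eq0 => /andP[/eqP uA /eqP uB].
  apply: (@row_free_mul0 _ _ _ _ G); first by rewrite row_free_unit.
  by rewrite mulmxDr !mulmxA uA uB !mul0mx addr0.
have full : row_full (row_mx A B) by rewrite /row_full (eqP fAB) em mul2n addnn.
pose e b' : 'rV[F]_n := \row_j ((b' == b) && (j == a))%:R.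
have /submxP[u eu] := submx_full (row_mx (e true) (e false)) full.
move: eu; rewrite mul_mx_row => /eq_row_mx[eA eB]; exists u => b' j.
by rewrite ccoefE; case: b'; rewrite -?eA -?eB mxE.
Qed.

(** The exponential of t times the infinitesimal rotation in the plane of u and v, whose square is
    zero when u and v span an isotropic space. *)
Definition shear t u v : 'M[F]_m := 1%:M + t *: (G *m v^T *m u - G *m u^T *m v).

Lemma shearE t u v w :
  w *m shear t u v = w + t *: (bform w v *: u - bform w u *: v).
Proof.
rewrite mulmxDr mulmx1 -scalemxAr mulmxBr; congr (_ + _ *: (_ - _)).
  by rewrite !mulmxA [w *m G *m v^T]mx11_scalar mul_scalar_mx.
by rewrite !mulmxA [w *m G *m u^T]mx11_scalar mul_scalar_mx.
Qed.

Lemma shearK t u v : bform u u = 0 -> bform v v = 0 -> bform u v = 0 ->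
  shear t u v *m shear (- t) u v = 1%:M.
Proof.
move=> uu vv uv; apply/row_matrixP => i; rewrite row_mul !rowE mulmx1.
move: (delta_mx 0 i) => w; rewrite !shearE.
have -> : bform (w + t *: (bform w v *: u - bform w u *: v)) v = bform w v.
  by rewrite addrC bformZBl uv vv !mulr0 subr0 mulr0 add0r.
have -> : bform (w + t *: (bform w v *: u - bform w u *: v)) u = bform w u.
  by rewrite addrC bformZBl uu (bformC _ _ v u) uv !mulr0 subr0 mulr0 add0r.
by rewrite scaleNr addrK.
Qed.

Lemma gam_sq0 u y : bform u u = 0 -> gam u (gam u y) = 0.
Proof.
move=> uu; have := clifford A B u u y; rewrite uu scale0r -mulr2n -scaler_nat.
by move/eqP; rewrite scaler_eq0 pnatr_eq0 => /eqP.
Qed.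

(* 1 + t u v is an element of the spin group lying over the shear. *)
Lemma killed_shear k (W : 'M[F]_(k, m)) t u v (y : spin) :
  bform u u = 0 -> bform v v = 0 -> bform u v = 0 ->
  killed W y -> killed (W *m shear t u v) (y + t *: gam u (gam v y)).
Proof.
move=> uu vv uv kW i; rewrite row_mul; move: (kW i); move: (row i W) => w kw.
have anti z a b : bform a b = 0 -> gam a (gam b z) = - gam b (gam a z).
  by move=> e; apply/eqP; rewrite -addr_eq0 clifford e scale0r.
have comm z a b : gam a (gam b z) = bform a b *: z - gam b (gam a z).
  by rewrite -clifford addrK.
have uuv : gam u (gam u (gam v y)) = 0 by apply: gam_sq0.
have vuv : gam v (gam u (gam v y)) = 0.
  by rewrite anti ?(bformC _ _ v u) // gam_sq0 // linear0 oppr0.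
have wuv : gam w (gam u (gam v y)) = bform w u *: gam v y - bform w v *: gam u y.
  by rewrite comm (comm y w v) kw linear0 subr0 linearZ.
have gE z : gam (w *m shear t u v) z =
    gam w z + t *: (bform w v *: gam u z - bform w u *: gam v z).
  rewrite shearE addrC gamDv -scaleNr gamDv -[_ *: v]addr0 gamDv gam0v addr0.
  by rewrite scaleNr addrC.
have gz a z : gam a (y + t *: z) = gam a y + t *: gam a z by rewrite linearD linearZ.
rewrite gE !gz kw uuv vuv wuv !scaler0 !addr0 add0r.
by rewrite -scalerDr addrA subrK subrr scaler0.
Qed.

(** Vertices of equal parity are at even distance. On a walk from I to J by double flips, some step
    leaves the zero set of y. *)
Lemma adjacent_zero y I J : y I = 0 -> y J != 0 -> parity I = parity J ->
  exists I' (a b : 'I_n), [/\ a != b, y I' = 0 & y (I' +e a +e b) != 0].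
Proof.
have [d] := ubnP #|[set i | I i != J i]%SET|; elim: d I => // d IH I dI yI yJ pIJ.
have ne I1 : I1 != J -> exists i, I1 i != J i.
  move=> neq; apply/existsP; apply: contraNT neq => /existsPn H.
  by apply/eqP/ffunP => i; have := H i; rewrite negbK => /eqP.
have [a Ia] : exists a, I a != J a by apply: ne; apply: contraNneq yJ => <-; rewrite yI.
have [b Ib] : exists b, (I +e a) b != J b.
  apply: ne; apply/eqP => e; have := parity_add I a; rewrite e pIJ.
  by case: (parity J).
have ab : a != b.
  apply: contraNneq Ib => <-; rewrite cube_addE eqxx.
  by move: Ia; case: (I a); case: (J a).
have [z|nz] := eqVneq (y (I +e a +e b)) 0; last by exists I, a, b.
apply: (IH (I +e a +e b)) => //; last by rewrite !parity_add negbK.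
rewrite -ltnS (leq_trans _ dI) // ltnS; apply: proper_card; apply/properP; split.
  apply/fintype.subsetP => i; rewrite !inE !cube_addE.
  have [->|ia] := eqVneq i a; first by rewrite Ia.
  have [->|ib] := eqVneq i b; last by rewrite !addbF.
  move: Ib; rewrite cube_addE [b == a]eq_sym (negPf ab) !addbF.
  by case: (I b); case: (J b).
exists a; rewrite !inE ?Ia // !cube_addE eqxx (negPf ab).
by move: Ia; case: (I a); case: (J a).
Qed.

(** Induction on the number of zero coordinates. In the pencil y + t w with w = [gam u (gam v y)],
    all but finitely many members have strictly larger support, and each is killed by a sheared W.
    So P vanishes on them, hence on the whole pencil, in particular at t = 0. *)
Lemma spinor_variety_dense (P : {mpoly F[#|cube n|]}) d :
  multihomog (@parity n) d P -> (forall x, Yring x -> peval P x = 0) ->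
  forall x, (forall b, exists2 I, parity I = b & x I != 0) ->
    (exists2 W : 'M[F]_(n - 1, m), row_free W & killed W (twist x)) -> peval P x = 0.
Proof.
move=> hP PY x; have [z] := ubnP #|[set I | x I == 0]%SET|.
elim: z x => // z IH x zx xb [W fW kW].
case: (boolP [exists I, x I == 0]); last first.
  move/existsPn => xn; apply: PY; apply/Yring_crel.
  have tn J : twist x J != 0 by rewrite twist_neq0.
  by split=> // *; apply: (killed_crel uG _ fW kW).
case/existsP=> I0 /eqP xI0; have [J pJ xJ] := xb (parity I0).
have [I [a [b [ab xI xIab]]]] := adjacent_zero xI0 xJ (esym pJ).
(* Chosen so that [gam u (gam v y)] at I is, up to sign, the nonzero value of y at [I +e a +e b]. *)
have [u uE] := basis_vector (I a) a; have [v vE] := basis_vector (I b) b.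
have uu : bform u u = 0.
  rewrite bformE big1 // => j _; rewrite !uE -!natrM !mulnb.
  by case: (I a); rewrite /= ?andbF addr0.
have vv : bform v v = 0.
  rewrite bformE big1 // => j _; rewrite !vE -!natrM !mulnb.
  by case: (I b); rewrite /= ?andbF addr0.
have uv : bform u v = 0.
  rewrite bformE big1 // => j _; rewrite !uE !vE -!natrM !mulnb.
  have [->|ja] := eqVneq j a; first by rewrite (negPf ab) !andbF addr0.
  by rewrite !andbF addr0.
pose y : spin := twist x; pose w := gam u (gam v y).
have wI : w I != 0.
  have s0 i J' : csign F i J' != 0 := csign_neq0 _ _ _.
  rewrite /w ffunE (bigD1 a) //= big1 => [|j /negPf ja]; last first.
    by rewrite uE ja andbF !mul0r.
  rewrite uE !eqxx addr0 mul1r mulf_neq0 // ffunE (bigD1 b) //= big1.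
    rewrite vE cube_addE [b == a]eq_sym (negPf ab) addbF !eqxx addr0 mul1r mulf_neq0 //.
    by rewrite twist_neq0.
  by move=> j /negPf jb; rewrite vE jb andbF !mul0r.
pose D := [pred J | (x J != 0) || (w J != 0)].
(* The roots of [r] are the bad parameters, where a coordinate not identically zero on the pencil
   vanishes. Multiplying by [r] makes the vanishing hold for every t. *)
pose r : {poly F} := \prod_(J | D J) ((y J : F)%:P + (w J : F)%:P * 'X).
have r0 : r != 0.
  apply/prodf_neq0 => J'; rewrite inE -(twist_neq0 x) => DJ; apply/eqP => e.
  have := congr1 (fun p : {poly F} => p.[0]) e.
  have := congr1 (fun p : {poly F} => p.[1]) e.
  rewrite !hornerE => e1 e0; move: DJ; rewrite -/y.
  by move: e1; rewrite e0 add0r => ->; rewrite eqxx.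
pose xt t : {ffun cube n -> F} := twist (y + t *: w).
have xtE t J' : xt t J' = (-1) ^+ tw J' * ((y J' : F) + (w J' : F) * t).
  rewrite [xt t J']ffunE; congr (_ * _).
  by rewrite ffunE [(t *: w) J']ffunE; congr (_ + _); exact: mulrC.
pose q : {poly F} := \sum_(k <- msupp P) (P@_k)%:P *
  \prod_i (((-1) ^+ tw (enum_val i))%:P *
     ((y (enum_val i) : F)%:P + (w (enum_val i) : F)%:P * 'X)) ^+ k i.
have qE t : q.[t] = peval P (xt t).
  rewrite /q /peval mevalE horner_sum; apply: eq_bigr => k _.
  rewrite hornerM hornerC horner_prod; congr (_ * _); apply: eq_bigr => i _.
  by rewrite horner_exp !hornerE xtE.
have qr : q * r = 0.
  apply: poly_all_roots_eq0 => t; rewrite hornerM.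
  have [->|rt] := eqVneq r.[t] 0; first by rewrite mulr0.
  have Dt J' : D J' -> xt t J' != 0.
    move=> DJ; rewrite xtE mulf_neq0 ?signr_eq0 //.
    move: rt; rewrite horner_prod => /prodf_neq0/(_ J' DJ).
    by rewrite !hornerE.
  rewrite qE (IH (xt t)) ?mul0r //.
  - rewrite -ltnS (leq_trans _ zx) // ltnS; apply: proper_card; apply/properP; split.
      apply/fintype.subsetP => J'; rewrite !inE; apply: contraTT => xJ'.
      by apply: Dt; rewrite inE xJ'.
    exists I; rewrite !inE ?xI //; apply: Dt.
    by rewrite inE wI orbT.
  - move=> b'; have [J' pJ' xJ'] := xb b'; exists J' => //.
    by apply: Dt; rewrite inE xJ'.
  exists (W *m shear t u v).
    rewrite /row_free mxrankMfree // row_free_unit.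
    by have /mulmx1_unit[] := shearK t uu vv uv.
  by rewrite /xt twistK; apply: killed_shear.
move/eqP: qr; rewrite mulf_eq0 (negPf r0) orbF => /eqP q0.
have := qE 0; rewrite q0 horner0 => ->; congr (peval P _).
by rewrite /xt scale0r addr0 twistK.
Qed.

Lemma Xvar_spinor_variety : Xvar F n = spinor_variety.
Proof.
apply/seteqP; split.
  apply: smallest_sub; first exact: spinor_variety_closed.
  move=> p [x Yx hx]; exists x => //; have /Yring_crel[y0 yR] := Yx.
  exact: crel_killed.
move=> p [x hx kx] Z [[S [hS ->]] XZ] P x' SP hx'.
have [d hP] := hS P SP.
apply: (spinor_variety_dense hP) => [z Yz|b|].
- have [q hq] : exists q : multiproj F (@parity n), hcoords q z.
    apply: hcoords_mk => b; have [I pI _] := hcoords_neq0 b hx.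
    by exists I => //; case: Yz.
  have Xq : Xring q by exists z.
  exact: (XZ q Xq P z SP hq).
- by have [I pI xI] := hcoords_neq0 b hx'; exists I.
case: kx => W fW kW; exists W => //; exact: killed_hcoords hx hx' kW.
Qed.

End SpinorVariety.

(** * The incidence correspondence *)

Section Incidence.
Variables (F : numClosedFieldType) (n m : nat) (A B : 'M[F]_(m, n)).
Local Notation G := (A *m B^T + B *m A^T).
Local Notation spin := {ffun cube n -> F^o}.
Local Notation gam := (gam A B).
Local Notation killed := (killed A B).
Local Notation gmx := (gmx A B).
Local Notation spinors := (spinor_variety A B).
Local Notation mpS := (multiproj F (@parity n)).
Local Notation mpG := (multiproj F (plucker_col m (n - 1))).
Hypothesis uG : G \in unitmx.
Hypothesis em : m = (2 * n)%N.
Hypothesis n0 : (0 < n)%N.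
Implicit Types (W : 'M[F]_(n - 1, m)) (x : {ffun cube n -> F}).

Definition iso_grass : set mpG :=
  [set p' | exists W, [/\ row_free W, W *m G *m W^T = 0 & hcoords p' (pl W)]].

(** The graph of the isomorphism, single-valued in both directions by [inc_uniqr] and
    [inc_uniql]. *)
Definition inc (p : mpS) (p' : mpG) : Prop :=
  exists x W, [/\ hcoords p x, hcoords p' (pl W), row_free W & killed W (twist x)].

Lemma hcoords_pl_ex W : row_free W -> exists p' : mpG, hcoords p' (pl W).
Proof.
by move=> /pl_neq0[S WS]; apply: hcoords_mk => -[]; exists S.
Qed.

Lemma spinors_inc p : spinors p -> exists p', inc p p'.
Proof.
by move=> [x hx [W fW kW]]; have [p' hp'] := hcoords_pl_ex fW; exists p', x, W.
Qed.

Lemma inc_spinors p p' : inc p p' -> spinors p.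
Proof. by move=> [x [W [hx _ fW kW]]]; exists x => //; exists W. Qed.

Lemma inc_iso_grass p p' : inc p p' -> iso_grass p'.
Proof.
move=> [x [W [hx hW fW kW]]]; exists W; split=> //.
apply: killed_isotropic kW; apply: contraNneq (hcoords_ppart hx true) => ->.
by rewrite linear0.
Qed.

(** Only the even part of y and the odd part of z are used: kernel vectors supplied by
    [local_kernel] are not known to have a definite parity. *)
Lemma inc_of_spinors W (p' : mpG) (y z : spin) : hcoords p' (pl W) -> row_free W ->
  killed W y -> killed W z -> ppart false y != 0 -> ppart true z != 0 ->
  exists2 p, inc p p' &
    hcoords p ([ffun I => (-1) ^+ tw I * if parity I then z I else y I]
      : {ffun cube n -> F}).
Proof.
move=> hW fW ky kz y0 z0; 
pose x : {ffun cube n -> F} :=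
  [ffun I => (-1) ^+ tw I * if parity I then z I else y I].
have nz b (w : spin) : ppart b w != 0 -> exists2 I, parity I = b & w I != 0.
  move=> w0; apply: contrapT => H; case/eqP: w0; apply/ffunP => I; rewrite !ffunE.
  case: eqP => // pI; apply/eqP/negPn/negP => wI; apply: H; by exists I.
have [p hp] : exists p : mpS, hcoords p x.
  apply: hcoords_mk => -[].
    have [I pI zI] := nz _ _ z0; exists I => //.
    by rewrite ffunE pI mulf_neq0 ?signr_eq0.
  have [I pI yI] := nz _ _ y0; exists I => //.
  by rewrite ffunE pI mulf_neq0 ?signr_eq0.
exists p => //; exists x, W; split=> // i.
have -> : twist x = ppart false y + ppart true z.
  apply/ffunP => I; rewrite !ffunE signrMK.
  by case: (parity I); rewrite /= ?addr0 ?add0r.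
by rewrite linearD /= !killed_ppart // addr0.
Qed.

Lemma iso_grass_inc p' : iso_grass p' -> exists p, inc p p'.
Proof.
move=> [W [fW iW hW]].
have [y [y0 yb ky _]] := ann_line uG n0 em false fW iW.
have [z [z0 zb kz _]] := ann_line uG n0 em true fW iW.
have [|| p ip _] := inc_of_spinors hW fW ky kz; rewrite ?yb ?zb //.
by exists p.
Qed.

Lemma inc_uniqr p p1 p2 : inc p p1 -> inc p p2 -> p1 = p2.
Proof.
move=> i1 i2; have Xp := inc_spinors i1.
case: i1 i2 => x [W1 [hx h1 f1 k1]] [x2 [W2 [hx2 h2 f2]]].
move/(killed_hcoords hx2 hx) => k2.
have rk : \rank (kermx (gmx x)) = (n - 1)%N.
  by rewrite mxrank_ker (gmx_rank uG em n0 hx Xp); lia.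
have s1 : (W1 <= kermx (gmx x))%MS by apply/sub_kermxP/killed_gmx.
have s2 : (W2 <= kermx (gmx x))%MS by apply/sub_kermxP/killed_gmx.
have /submxP[T eT] : (W1 <= W2)%MS.
  apply: submx_trans s1 _.
  by have [_ <-] := mxrank_leqif_sup s2; rewrite (eqP f2) rk.
have dT : \det T != 0.
  rewrite -unitfE -unitmxE -row_free_unit -row_leq_rank -{1}(eqP f1) eT.
  exact: mxrankM_maxl.
apply: hcoords_inj h1 _; apply: (scale_hcoords (t := fun=> \det T) h2) => // S.
by rewrite eT plM ffunE.
Qed.

Lemma inc_uniql p1 p2 p' : inc p1 p' -> inc p2 p' -> p1 = p2.
Proof.
move=> i1 i2; have [W [fW iW hW]] := inc_iso_grass i1.
have K (p : mpS) x : inc p p' -> hcoords p x -> killed W (twist x).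
  move=> [x' [W' [hx' hW' fW' kW']]] hx; apply: (killed_hcoords hx' hx).
  have [t t0 e] := hcoords_scale hW hW'.
  apply: killed_sub kW'; apply: (pl_sub (t0 tt) fW).
  by apply/ffunP => S; rewrite [RHS]ffunE e.
have [x1 h1] := hcoords_ex p1; have [x2 h2] := hcoords_ex p2.
have k1 := K _ _ i1 h1; have k2 := K _ _ i2 h2.
have H b : exists t, t != 0 /\ ppart b (twist x2) = t *: ppart b (twist x1).
  have [y [y0 yb ky L]] := ann_line uG n0 em b fW iW.
  have [t1 e1] := L _ k1; have [t2 e2] := L _ k2.
  have := hcoords_ppart h1 b; have := hcoords_ppart h2 b.
  rewrite e1 e2 !scaler_eq0 (negPf y0) !orbF => t20 t10.
  exists (t2 / t1); split; first by rewrite mulf_neq0 ?invr_eq0.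
  by rewrite scalerA mulfVK.
have [t Ht] := choice H.
apply: hcoords_inj h2; apply: (scale_hcoords (t := t) h1) => [b|I].
  by case: (Ht b).
have [_ /ffunP/(_ I)] := Ht (parity I); rewrite !ffunE eqxx.
rewrite [t _ *: _]mulrCA => /(mulfI _); apply.
by rewrite signr_eq0.
Qed.

Lemma spinors_to_grass_polynomial (f : mpS -> mpG) :
  (forall p, spinors p -> inc p (f p)) -> locally_polynomial spinors f.
Proof.
move=> hf p Xp; have [x0 hx0] := hcoords_ex p.
have r0 := gmx_rank uG em n0 hx0 Xp.
have [|K0 fK0 sK0] := @sub_row_free _ _ _ (n - 1) (kermx (gmx x0)).
  by rewrite mxrank_ker r0; lia.
have /sub_kermxP K00 := sK0.
have [e [delta [Kf [hd hK d0 _ Kx]]]] := local_kernel (gmx_homog A B) fK0 K00.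
exists e, delta, (fun k => \sum_(j < n - 1) e k)%N, (fun x => pl (Kf x)).
split=> //; last first.
- move=> q x Xq hx dx; have [|fK kK] := Kx x _ dx.
    by rewrite r0 (gmx_rank uG em n0 hx Xq).
  have [p' hp'] := hcoords_pl_ex fK.
  rewrite (@inc_uniqr q (f q) p') //; first exact: hf.
  by exists x, (Kf x); split=> //; apply/killed_gmx.
- by exists x0.
move=> S.
apply: (@homogfun_ext _ _ _ _ _ _ (fun x => \det (colsub (kelem S) (Kf x)))) => //.
  by move=> x; rewrite ffunE.
apply: (@homogfun_det _ _ _ _ _ (fun _ => e)) => i j.
by apply: homogfun_ext (hK i (kelem S j)) => // x; rewrite [RHS]mxE.
Qed.

Definition row_spinor (r : 'rV[F]_#|cube n|) : spin :=
  [ffun I : cube n => r 0 (enum_rank I)].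

Definition spinor_row (y : spin) : 'rV[F]_#|cube n| := \row_t (y (enum_val t) : F).

Lemma row_spinorK y : row_spinor (spinor_row y) = y.
Proof. by apply/ffunP => I; rewrite ffunE mxE enum_rankK. Qed.

Definition kill_index : finType := ('I_(n - 1) * cube n)%type.

Definition killmx W : 'M[F]_(#|cube n|, #|kill_index|) :=
  \matrix_(s, t) gam (row (enum_val t).1 W) (row_spinor (delta_mx 0 s)) (enum_val t).2.

Lemma killmxE W (r : 'rV_#|cube n|) t :
  (r *m killmx W) 0 t = gam (row (enum_val t).1 W) (row_spinor r) (enum_val t).2.
Proof.
have -> : row_spinor r = \sum_s r 0 s *: row_spinor (delta_mx 0 s).
  apply/ffunP => I; rewrite sum_ffunE (bigD1 (enum_rank I)) //= big1 => [|s sI].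
    by rewrite !ffunE mxE !eqxx addr0; symmetry; exact: mulr1.
  rewrite !ffunE mxE eqxx /= eq_sym (negPf sI); exact: mulr0.
rewrite linear_sum sum_ffunE mxE; apply: eq_bigr => s _.
by rewrite mxE linearZ [RHS]ffunE.
Qed.

Lemma killmx_killed W (r : 'rV_#|cube n|) :
  r *m killmx W = 0 <-> killed W (row_spinor r).
Proof.
split=> [e i|kW].
  apply/ffunP => I; have := killmxE W r (enum_rank ((i, I) : kill_index)).
  by rewrite enum_rankK e mxE => <-; rewrite ffunE.
by apply/rowP => t; rewrite killmxE kW ffunE mxE.
Qed.

Lemma killmx_homog (A' K' : finType) (c : A' -> K') d
    (E : {ffun A' -> F} -> 'M[F]_(n - 1, m)) s t :
  (forall i j, homogfun c d (fun z => E z i j)) ->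
  homogfun c d (fun z => killmx (E z) s t).
Proof.
move=> hE; case et : (enum_val t) => [i J].
pose h z := \sum_l E z i l * gam (delta_mx 0 l) (row_spinor (delta_mx 0 s)) J.
apply: (@homogfun_ext _ _ _ _ _ _ h) => // [z|].
  rewrite mxE et /=.
  have := @gam_sum _ _ _ A B _ 1%:M (row i (E z)) (row_spinor (delta_mx 0 s)).
  rewrite mulmx1 => ->; rewrite sum_ffunE; apply: eq_bigr => l _.
  by rewrite [RHS]ffunE row1 mxE.
apply: homogfun_sum => l _ _.
set a := gam _ _ _.
apply: homogfun_ext (homogfunZ a (hE i l)) => // z.
by rewrite mulrC.
Qed.

(** The rows of Y are the even and the odd line given by [ann_line]; they span the left kernel, so
    the rank is the same for every isotropic W. *)
Lemma killmx_kernel W : row_free W -> W *m G *m W^T = 0 ->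
  exists Y : 'M[F]_(2, #|cube n|),
  [/\ row_free Y, Y *m killmx W = 0,
      \rank (killmx W) = (#|cube n| - 2)%N,
      ppart false (row_spinor (row 0 Y)) != 0 &
      ppart true (row_spinor (row 1 Y)) != 0].
Proof.
move=> fW iW.
have [y [y0 yb ky Ly]] := ann_line uG n0 em false fW iW.
have [z [z0 zb kz Lz]] := ann_line uG n0 em true fW iW.
pose Y : 'M[F]_(2, #|cube n|) := \matrix_i spinor_row (if i == 0 then y else z).
have Y0 : row 0 Y = spinor_row y by rewrite rowK.
have Y1 : row 1 Y = spinor_row z by rewrite rowK.
have rsD (r r' : 'rV_#|cube n|) (a b : F) :
    row_spinor (a *: r + b *: r') = a *: row_spinor r + b *: row_spinor r'.
  by apply/ffunP => I; rewrite !ffunE !mxE.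
have uY (u : 'rV_2) : u *m Y = u 0 0 *: spinor_row y + u 0 1 *: spinor_row z.
  by rewrite mulmx_sum_row !big_ord_recl big_ord0 addr0 Y0
    (_ : lift ord0 ord0 = 1) ?Y1 //; apply: val_inj.
have fY : row_free Y.
  apply: row_free0P => u; rewrite uY => e.
  have : row_spinor (u 0 0 *: spinor_row y + u 0 1 *: spinor_row z) = 0.
    by rewrite e; apply/ffunP => I; rewrite !ffunE mxE.
  rewrite rsD !row_spinorK => e'.
  have := congr1 (ppart false) e'; have := congr1 (ppart true) e'.
  rewrite !linearD !linearZ /= !linear0 zb yb.
  rewrite -{1}yb (ppart_neg false) -{2}zb (ppart_neg true) !scaler0 add0r addr0.
  move=> /eqP; rewrite scaler_eq0 (negPf z0) orbF => /eqP u1.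
  move=> /eqP; rewrite scaler_eq0 (negPf y0) orbF => /eqP u0.
  apply/rowP => i; rewrite mxE.
  by case: i => [[|[|]]] // h; [rewrite -[RHS]u0|rewrite -[RHS]u1];
    congr (u 0 _); apply: val_inj.
have YK : Y *m killmx W = 0.
  apply/row_matrixP => i; rewrite row_mul row0; apply/killmx_killed.
  by rewrite rowK row_spinorK; case: ifP.
exists Y; split=> //; rewrite ?Y0 ?Y1 ?row_spinorK ?yb ?zb //.
have : (kermx (killmx W) == Y)%MS.
  apply/andP; split; last exact/sub_kermxP.
  apply/row_subP => i; set r := row i _.
  have /killmx_killed kr : r *m killmx W = 0 by rewrite -row_mul mulmx_ker row0.
  have [a ea] := Ly _ kr; have [b eb] := Lz _ kr.
  apply/submxP; exists (\row_j if j == 0 then a else b); rewrite uY !mxE /=.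
  apply/rowP => t.
  have := congr1 (fun w : spin => w (enum_val t)) (ppart_split (row_spinor r)).
  by rewrite ea eb !ffunE enum_valK => ->; rewrite !mxE.
move/eqmx_rank; rewrite (eqP fY) mxrank_ker => e.
by have := rank_leq_row (killmx W); lia.
Qed.

Lemma grass_to_spinors_polynomial (g : mpG -> mpS) :
  (forall p', iso_grass p' -> inc (g p') p') -> locally_polynomial iso_grass g.
Proof.
move=> hg p' Xp'; have [z0 hz0] := hcoords_ex p'.
have [W [fW iW hW]] := Xp'.
have [S WS] := pl_neq0 fW.
(* [E] turns Pluecker coordinates into an actual matrix of the subspace, whose entries are linear
   forms; only then can spinors be computed by polynomials. *)
have [E [hE EZ Epl]] := plucker_echelon F S.
have EP q z : iso_grass q -> hcoords q z -> z S != 0 ->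
    [/\ row_free (E z), E z *m G *m (E z)^T = 0 & hcoords q (pl (E z))].
  move=> [V [fV iV hV]] hz zS; have [t t0 e] := hcoords_scale hV hz.
  have ez : z = [ffun S => t tt * pl V S] by apply/ffunP => S'; rewrite [RHS]ffunE e.
  pose T := t tt *: \adj (colsub (kelem S) V).
  have EzT : E z = T *m V by rewrite ez EZ Epl -scalemxAl.
  have uT : T \in unitmx.
    move: zS; rewrite ez ffunE mulf_eq0 negb_or ffunE => /andP[_ dV].
    rewrite unitmxZ ?unitfE //; have := mul_adj_mx (colsub (kelem S) V).
    move/(congr1 (fun Q => Q *m (\det (colsub (kelem S) V))^-1%:M)).
    by rewrite -mulmxA -scalar_mxM mulfV // => /mulmx1_unit[].
  have fE : row_free (E z) by rewrite EzT /row_free mxrankMfree // mxrank_unit.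
  split=> //.
    by rewrite EzT trmx_mul !mulmxA -(mulmxA T) -(mulmxA T) iV mulmx0 mul0mx.
  apply: (scale_hcoords (t := fun=> \det T) hV) => [_|S'].
    by rewrite -unitfE -unitmxE.
  by rewrite EzT plM ffunE.
have z0S : z0 S != 0.
  have [t t0 ->] := hcoords_scale hW hz0; exact: mulf_neq0.
have [fE0 iE0 _] := EP _ _ Xp' hz0 z0S.
have [Y [fY YK rY Y0 Y1]] := killmx_kernel fE0 iE0.
have hM s t : homogfun (plucker_col m (n - 1)) (fun=> 1%N) (fun z => killmx (E z) s t).
  exact: killmx_homog.
have [e [delta [Kf [hd hK d0 Kf0 Kx]]]] :=
  @local_kernel _ _ _ _ _ _ _ (fun _ _ => 1%N) (fun z => killmx (E z)) hM z0 Y fY YK.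
have nz b (w : 'rV_#|cube n|) : ppart b (row_spinor w) != 0 ->
    exists2 s, parity (enum_val s) = b & w 0 s != 0.
  move=> w0; apply: contrapT => H; case/eqP: w0; apply/ffunP => I; rewrite !ffunE.
  case: eqP => // pI; apply/eqP/negPn/negP => wI; apply: H.
  by exists (enum_rank I); rewrite ?enum_rankK.
have [s0 ps0 ys0] := nz _ _ Y0; have [s1 ps1 ys1] := nz _ _ Y1.
pose phi (z : {ffun ksubset m (n - 1) -> F}) : {ffun cube n -> F} :=
  [ffun I => (-1) ^+ tw I *
     if parity I then Kf z 1 (enum_rank I) else Kf z 0 (enum_rank I)].
(* The factors ensure in turn that [Kf z] is a basis of the kernel, that the even part of its row 0
   and the odd part of its row 1 are nonzero, and that [z] lies in the chart of [S]. *)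
pose delta' (z : {ffun ksubset m (n - 1) -> F}) :=
  delta z * Kf z 0 s0 * (Kf z 1 s1 * z S).
exists (fun k => (e k + e k) + (e k + 1))%N, delta', e, phi; split.
- apply: homogfunM; first by apply: homogfunM.
  apply: homogfunM => //.
  by apply: homogfun_ext (homogfun_coord _ _ S) => // -[].
- move=> I; case pI: (parity I).
    apply: homogfun_ext (homogfunZ ((-1) ^+ tw I) (hK 1 (enum_rank I))) => // z.
    by rewrite ffunE pI.
  apply: homogfun_ext (homogfunZ ((-1) ^+ tw I) (hK 0 (enum_rank I))) => // z.
  by rewrite ffunE pI.
- exists z0 => //; rewrite /delta' Kf0 !mxE; move: ys0 ys1; rewrite !mxE => ys0 ys1.
  by rewrite !mulf_neq0.
move=> q z Xq hz; rewrite /delta' !mulf_eq0 !negb_or.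
move=> /andP[/andP[dz k0] /andP[k1 zS]].
have [fE iE hEz] := EP _ _ Xq hz zS.
have [_ [_ _ rz _ _]] := killmx_kernel fE iE.
have [|fK KK] := Kx z _ dz; first by rewrite rY rz.
have kr i : killed (E z) (row_spinor (row i (Kf z))).
  by apply/killmx_killed; rewrite -row_mul KK row0.
have pn b i s : parity (enum_val s) = b -> Kf z i s != 0 ->
    ppart b (row_spinor (row i (Kf z))) != 0.
  move=> ps; apply: contraNneq => /ffunP/(_ (enum_val s)).
  by rewrite !ffunE ps eqxx enum_valK mxE => ->.
have [p ip hp] := inc_of_spinors hEz fE (kr 0) (kr 1)
  (pn _ _ _ ps0 k0) (pn _ _ _ ps1 k1).
rewrite (inc_uniql (hg _ Xq) ip).
suff -> : phi z = [ffun I : cube n => (-1) ^+ tw I *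
  (if parity I then row_spinor (row 1 (Kf z)) I else row_spinor (row 0 (Kf z)) I : F)] by [].
by apply/ffunP => I; rewrite !ffunE !mxE.
Qed.

Lemma spinors_iso_grass : isomorphic_varieties spinors iso_grass.
Proof.
(* [f] and [g] must be total functions; [p0'] and [p0] are arbitrary values for them off the two
   varieties. *)
have [p0' _] : exists p' : mpG, True.
  have [|p' _] := @hcoords_pl_ex (pid_mx (n - 1)); last by exists p'.
  by rewrite /row_free rank_pid_mx //; lia.
have [p0 _] : exists p : mpS, True.
  pose z : cube n := [ffun=> false].
  have pz : parity z = false by rewrite /parity big1 // => i _; rewrite ffunE.
  have [|p _] := @hcoords_mk F _ _ (@parity n) [ffun=> 1]; last by exists p.
  case; last by exists z => //; rewrite ffunE oner_eq0.
  by exists (z +e Ordinal n0); rewrite ?parity_add ?pz // ffunE oner_eq0.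
have /choice[f hf] : forall p, exists p', spinors p -> inc p p'.
  move=> p; have [/spinors_inc[p' ip]|np] := pselect (spinors p).
    by exists p'.
  by exists p0'.
have /choice[g hg] : forall p', exists p, iso_grass p' -> inc p p'.
  move=> p'; have [/iso_grass_inc[p ip]|np] := pselect (iso_grass p').
    by exists p.
  by exists p0.
have fG p : spinors p -> iso_grass (f p) by move/hf/inc_iso_grass.
have gS p' : iso_grass p' -> spinors (g p') by move/hg/inc_spinors.
exists f, g; split.
- exact: locally_polynomial_morphism (spinors_to_grass_polynomial hf).
- exact: locally_polynomial_morphism (grass_to_spinors_polynomial hg).
- by move=> p Xp; apply: inc_uniql (hg _ (fG _ Xp)) (hf _ Xp).
by move=> p' Xp'; apply: inc_uniqr (hf _ (gS _ Xp')) (hg _ Xp').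
Qed.

End Incidence.

(** * The Gram matrix of the form, and the isotropic Grassmannian in terms of matrices *)

Section QuadraticForm.
Variables (F : numClosedFieldType) (m : nat) (q : 'rV[F]_m -> F).
Hypothesis hq : quadratic_form q.
Implicit Types u v : 'rV[F]_m.

Definition gram : 'M[F]_m := \matrix_(i, j) polar q (delta_mx 0 i) (delta_mx 0 j).

Lemma polarC u v : polar q u v = polar q v u.
Proof. by rewrite /polar [u + v]addrC addrAC. Qed.

Lemma polar_sum u v : polar q u v = \sum_j v 0 j * polar q u (delta_mx 0 j).
Proof.
have lin a w z : polar q u (a *: w + z) = a * polar q u w + polar q u z by apply: hq.2.
rewrite {1}[v]row_sum_delta; elim/big_rec2: _ => [|j w z _ <-]; last exact: lin.
by have /eqP := lin (-1) 0 0; rewrite scaler0 addr0 mulN1r addNr => /eqP.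
Qed.

Lemma polar_gram u v : polar q u v = (u *m gram *m v^T) 0 0.
Proof.
rewrite polar_sum mxE; apply: eq_bigr => j _; rewrite [v^T _ _]mxE mulrC; congr (_ * _).
rewrite polarC polar_sum mxE; apply: eq_bigr => i _; rewrite mxE; congr (_ * _).
exact: polarC.
Qed.

Lemma gram_sym : gram^T = gram.
Proof. by apply/matrixP => i j; rewrite !mxE polarC. Qed.

Lemma gram_unit : nondegenerate_form q -> gram \in unitmx.
Proof.
move=> nd; rewrite -row_free_unit; apply: row_free0P => u u0; apply: nd => v.
by rewrite polar_gram u0 mul0mx mxE.
Qed.

Lemma IG_gram k : IG k q =
  [set p | exists W : 'M[F]_(k, m),
     [/\ row_free W, W *m gram *m W^T = 0 & hcoords p (pl W)]].
Proof.
have rowsE (W : 'M[F]_(k, m)) : \matrix_i tnth [tuple row i W | i < k] i = W.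
  by apply/row_matrixP => i; rewrite rowK tnth_mktuple.
have freeE (b : k.-tuple 'rV[F]_m) : free b = row_free (\matrix_i tnth b i).
  apply/freeP/idP => [fb|fb c c0].
    apply: row_free0P => u; rewrite mulmx_sum_row => u0; apply/rowP => i; rewrite mxE.
    apply: (fb (fun i => u 0 i)); rewrite -[RHS]u0; apply: eq_bigr => t _.
    by rewrite rowK (tnth_nth 0).
  have : (\row_i c i) *m (\matrix_i tnth b i) = 0.
    rewrite mulmx_sum_row -[RHS]c0; apply: eq_bigr => t _.
    by rewrite rowK (tnth_nth 0) mxE.
  by move/(row_free_mul0 fb)/rowP => e i; have := e i; rewrite !mxE.
apply/seteqP; split=> p /=.
  move=> [U [b [[_ iU] bU hp]]]; exists (\matrix_i tnth b i); split.
  - by rewrite -freeE; apply: basis_free bU.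
  - apply/matrixP => i j; rewrite [RHS]mxE -[RHS](iU (tnth b i) (tnth b j)).
    + rewrite polar_gram -!(rowK (tnth b)) -row_mul tr_row !mxE.
      by apply: eq_bigr => t _; rewrite !mxE.
    + by apply: (basis_mem bU); apply: mem_tnth.
    + by apply: (basis_mem bU); apply: mem_tnth.
  - by rewrite -plucker_pl.
move=> [W [fW iW hp]]; pose b := [tuple row i W | i < k].
have fb : free b by rewrite freeE rowsE.
have bU : basis_of <<b>>%VS b by rewrite /basis_of eqxx.
exists <<b>>%VS, b; split=> //; last by rewrite plucker_pl rowsE.
split; first by move: fb; rewrite /free size_tuple => /eqP.
have sub u : u \in <<b>>%VS -> (u <= W)%MS.
  move/coord_span->; apply: summx_sub => i _; apply: scalemx_sub.
  by rewrite -tnth_nth tnth_mktuple row_sub.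
move=> u v /sub/submxP[x ->] /sub/submxP[y ->].
by rewrite polar_gram trmx_mul !mulmxA -(mulmxA x) -(mulmxA x) iW mulmx0 mul0mx mxE.
Qed.

End QuadraticForm.

Theorem theorem2 (R : realType) (n : nat) (hn : (3 <= n)%N)
    (q : 'rV[R[i]]_(2 * n) -> R[i])
    (hq : quadratic_form q) (hnd : nondegenerate_form q) :
  isomorphic_varieties (Xvar R[i] n) (IG (n - 1)%N q).
Proof.
have [A [B eG]] := hyperbolic_factor (gram_sym q) (erefl (2 * n)%N).
have n0 : (0 < n)%N := ltn_trans (isT : (0 < 2)%N) hn.
have uG := gram_unit hq hnd; rewrite eG in uG.
rewrite (Xvar_spinor_variety uG (erefl _) n0) (IG_gram hq) eG.
exact: spinors_iso_grass.
Qed.
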